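(* Let $k\ge 1$ be an integer and $\theta = 2\pi/(4k+3)$. Let $P$ be a finite set of points in general position and $S$ a set of constraints on $P$. Let $u,w\in P$ be two vertices such that $u$ can see $w$, let $m$ be the midpoint of the side of the canonical triangle $T_{uw}$ opposite $u$, and let $\alpha$ be the unsigned angle between $uw$ and $um$. Then there exists a path connecting $u$ and $w$ in the constrained $\theta_{(4k+3)}$-graph of $P$ with respect to $S$ of length at most \[\left( \frac{\cos \alpha}{\cos \left(\frac{\theta}{2}\right)} + \frac{\left( \cos \alpha \cdot \tan \left(\frac{\theta}{2}\right) + \sin \alpha \right) \cdot \cos \left(\frac{\theta}{4}\right)}{\cos \left(\frac{\theta}{2}\right) - \sin \left(\frac{3\theta}{4}\right)} \right) \cdot |u w|.\]
   Context: $P$ is a finite set of points in the plane and $S$ is a set of line segments (called constraints), each joining two points of $P$, such that no two constraints intersect properly. Two points $u,v\in P$ can see each other if and only if the segment $uv$ does not properly intersect any constraint or $uv$ is itself a constraint. Fix an integer $k\ge 1$, $x\in\{2,3,4,5\}$ and $\theta=2\pi/(4k+x)$. Around each point $u$, the $4k+x$ rays from $u$ with angle $\theta$ between consecutive rays define cones; they are oriented so that the bisector of one cone, $C_0^u$, is the vertical half-line above $u$, and the cones are numbered $C_0^u, C_1^u, \dots$ clockwise; all points use the same orientation. For every constraint $uv$ with $v\in C_i^u$, the line through that constraint splits $C_i^u$; the resulting pieces are the subcones of $C_i^u$ (if a constraint $uv$ splits a cone of $u$ into two subcones, $v$ is considered to lie in both; a cone not split is a single subcone). The constrained $\theta_{(4k+x)}$-graph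 has vertex set $P$ and, for each vertex $u$ and each subcone of each cone $C_i^u$, an edge between $u$ and the vertex $v$ of that subcone that can see $u$ and whose orthogonal projection onto the bisector of the full cone $C_i^u$ (not of the subcone) is closest to $u$ among all vertices of that subcone that can see $u$. Edges are weighted by Euclidean length, and the length of a path is the sum of its edge lengths. General position: no two points lie on a line parallel to one of the rays defining the cones, no two points lie on a line perpendicular to the bisector of a cone, and no three points are collinear. For a vertex $w$ in cone $C_i^u$, the canonical triangle $T_{uw}$ is the triangle bounded by the two boundary rays of $C_i^u$ and the line through $w$ perpendicular to the bisector of $C_i^u$. *)

(* Defs.v *)
From Stdlib Require Import Reals List.
Open Scope R_scope.

Definition point := (R * R)%type.

Definition edist (p q : point) : R :=
  sqrt ((fst q - fst p) ^ 2 + (snd q - snd p) ^ 2).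

Definition orient (a b c : point) : R :=
  (fst b - fst a) * (snd c - snd a) - (snd b - snd a) * (fst c - fst a).

Definition proper_cross (a b c d : point) : Prop :=
  orient a b c * orient a b d < 0 /\ orient c d a * orient c d b < 0.

Definition ncones (k x : nat) : nat := (4 * k + x)%nat.
Definition theta (k x : nat) : R := 2 * PI / INR (ncones k x).

Section Theta.
Variables (k x : nat) (P : list point) (S : list (point * point)).

Definition is_constraint (u v : point) : Prop := In (u, v) S \/ In (v, u) S.

Definition sees (u v : point) : Prop :=
  is_constraint u v \/
  forall c, In c S -> ~ proper_cross u v (fst c) (snd c).

(* Angle phi (measured clockwise from the upward vertical) of v seen from u
   lies strictly inside the cone C_i^u, whose bisector has angle i*theta. *)
Definition cone_angle (u v : point) (i : nat) (phi : R) : Prop :=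
  (i < ncones k x)%nat /\
  INR i * theta k x - theta k x / 2 < phi < INR i * theta k x + theta k x / 2 /\
  exists r, 0 < r /\ fst v - fst u = r * sin phi /\ snd v - snd u = r * cos phi.

Definition in_cone (u v : point) (i : nat) : Prop := exists phi, cone_angle u v i phi.

Definition bis_proj (u v : point) (i : nat) : R :=
  (fst v - fst u) * sin (INR i * theta k x) + (snd v - snd u) * cos (INR i * theta k x).

Definition crit_angle (u : point) (i : nat) (a : R) : Prop :=
  a = INR i * theta k x - theta k x / 2 \/ a = INR i * theta k x + theta k x / 2 \/
  exists c, is_constraint u c /\ cone_angle u c i a.

Definition subcone (u : point) (i : nat) (a b : R) : Prop :=
  (i < ncones k x)%nat /\ a < b /\ crit_angle u i a /\ crit_angle u i b /\
  ~ (exists c phi, is_constraint u c /\ cone_angle u c i phi /\ a < phi < b).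

(* v lies in the subcone [a,b] of C_i^u (constraint endpoints on its
   bounding rays belong to it) *)
Definition in_subcone (u : point) (i : nat) (a b : R) (v : point) : Prop :=
  exists phi, cone_angle u v i phi /\ a <= phi <= b.

Definition chosen (u v : point) : Prop :=
  In u P /\ In v P /\
  exists i a b, subcone u i a b /\ in_subcone u i a b v /\ sees u v /\
    forall w, In w P -> in_subcone u i a b w -> sees u w ->
      bis_proj u v i <= bis_proj u w i.

Definition theta_edge (u v : point) : Prop := chosen u v \/ chosen v u.

Fixpoint is_path (a : point) (l : list point) (b : point) : Prop :=
  match l with
  | nil => a = b
  | c :: l' => theta_edge a c /\ is_path c l' b
  end.

End Theta.

Fixpoint path_len (a : point) (l : list point) : R :=
  match l with
  | nil => 0
  | c :: l' => edist a c + path_len c l'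
  end.

Definition general_position (k x : nat) (P : list point) : Prop :=
  (forall a b c, In a P -> In b P -> In c P -> a <> b -> b <> c -> a <> c ->
     orient a b c <> 0) /\
  (* no two points on a line parallel to a ray defining the cones *)
  (forall a b j, In a P -> In b P -> a <> b -> (j < ncones k x)%nat ->
     let g := INR j * theta k x + theta k x / 2 in
     (fst b - fst a) * cos g - (snd b - snd a) * sin g <> 0) /\
  (* no two points on a line perpendicular to the bisector of a cone *)
  (forall a b j, In a P -> In b P -> a <> b -> (j < ncones k x)%nat ->
     (fst b - fst a) * sin (INR j * theta k x) + (snd b - snd a) * cos (INR j * theta k x) <> 0).

Definition valid_constraints (P : list point) (S : list (point * point)) : Prop :=
  (forall c, In c S -> In (fst c) P /\ In (snd c) P /\ fst c <> snd c) /\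
  (forall c d, In c S -> In d S -> ~ proper_cross (fst c) (snd c) (fst d) (snd d)).

Definition uangle (o p q : point) : R :=
  acos (((fst p - fst o) * (fst q - fst o) + (snd p - snd o) * (snd q - snd o))
        / (edist o p * edist o q)).

(* midpoint of the side of the canonical triangle T_uw opposite u, where w in C_i^u *)
Definition canon_mid (k x : nat) (u w : point) (i : nat) : point :=
  (fst u + bis_proj k x u w i * sin (INR i * theta k x),
   snd u + bis_proj k x u w i * cos (INR i * theta k x)).

(* Main.v *)
Require Import Defs.
From Stdlib Require Import Reals List Lra Psatz Lia ZArith ClassicalEpsilon.
Open Scope R_scope.

(** Write h and s for the coordinates of a vector along and across the bisector
    of the cone C_i, and let c be the constant cos(th/4) / (cos(th/2) - sin(3th/4)).
    By induction on |uw|, a visible pair u, w with w in C_i^u is joined by a path of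
    length at most max(L, R), where L(e) and R(e) = h/cos(th/2) + c (h tan(th/2) +- s)
    are linear in e = w - u.

    Let v0 be the vertex chosen by u in the subcone of w, say to the left of uw.
    The points of P in the triangle u v0 w have a convex hull whose side facing u is
    a chain of visibility edges from v0 to w.  All its edges go upwards (h > 0), are
    shorter than uw, and turn monotonically to the left.  With an odd number of cones,
    every edge makes an angle g <= th/4 with the bisector of a cone at one of its two
    ends; since cos x / cos(th/2) + c (sin x + cos x tan(th/2)) is concave and takes the
    same value at th/4 and pi/2, the induction hypothesis bounds each edge e
    by L(e) if it goes right and by R(e) if it goes left.  Summing along the chain, and
    using that all vertices lie left of the bisector as soon as an edge goes left, gives
    the bound for u, w. *)

Definition comb (u v w : point) (b g : R) (x : point) : Prop :=
  fst x - fst u = b * (fst v - fst u) + g * (fst w - fst u) /\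
  snd x - snd u = b * (snd v - snd u) + g * (snd w - snd u).

Definition inside (u v w x : point) : Prop :=
  exists b g, 0 < b /\ 0 < g /\ b + g < 1 /\ comb u v w b g x.

Lemma comb_exists (u v w x : point) :
  orient u v w <> 0 -> exists b g, comb u v w b g x.
Proof.
  intros HD. exists (orient u x w / orient u v w), (orient u v x / orient u v w).
  unfold comb, orient in *; split; field; exact HD.
Qed.

Lemma comb_origin (u v w : point) : comb u v w 0 0 u.
Proof. unfold comb; split; ring. Qed.

Lemma comb_left (u v w : point) : comb u v w 1 0 v.
Proof. unfold comb; split; ring. Qed.

Lemma comb_right (u v w : point) : comb u v w 0 1 w.
Proof. unfold comb; split; ring. Qed.

Lemma comb_compose (u v w x y : point) (b g l m : R) :
  comb u v w b g x -> comb u x w l m y -> comb u v w (l * b) (l * g + m) y.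
Proof.
  intros [H1 H2] [H3 H4]; unfold comb; rewrite H3, H4, H1, H2; split; ring.
Qed.

Lemma comb_compose_left (u v w x y : point) (b g l m : R) :
  comb u v w b g x -> comb u v x l m y -> comb u v w (l + m * b) (m * g) y.
Proof.
  intros [H1 H2] [H3 H4]; unfold comb; rewrite H3, H4, H1, H2; split; ring.
Qed.

Lemma orient_comb (u v w a b c : point) (a2 a3 b2 b3 c2 c3 : R) :
  comb u v w a2 a3 a -> comb u v w b2 b3 b -> comb u v w c2 c3 c ->
  orient a b c = orient u v w * orient (a2, a3) (b2, b3) (c2, c3).
Proof.
  unfold comb, orient; cbn [fst snd].
  intros [A1 A2] [B1 B2] [C1 C2].
  replace (fst b - fst a) with ((fst b - fst u) - (fst a - fst u)) by ring.
  replace (snd b - snd a) with ((snd b - snd u) - (snd a - snd u)) by ring.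
  replace (fst c - fst a) with ((fst c - fst u) - (fst a - fst u)) by ring.
  replace (snd c - snd a) with ((snd c - snd u) - (snd a - snd u)) by ring.
  rewrite A1, A2, B1, B2, C1, C2. ring.
Qed.

(** Every orientation is scaled by the determinant [orient u v w], whose square is positive, so
    signs of products survive. Crossings can thus be studied in the reference triangle. *)
Lemma proper_cross_comb (u v w a b c d : point) (a2 a3 b2 b3 c2 c3 d2 d3 : R) :
  orient u v w <> 0 ->
  comb u v w a2 a3 a -> comb u v w b2 b3 b ->
  comb u v w c2 c3 c -> comb u v w d2 d3 d ->
  proper_cross a b c d <-> proper_cross (a2, a3) (b2, b3) (c2, c3) (d2, d3).
Proof.
  intros HD Ha Hb Hc Hd; unfold proper_cross.
  rewrite (orient_comb _ _ _ _ _ _ _ _ _ _ _ _ Ha Hb Hc),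
    (orient_comb _ _ _ _ _ _ _ _ _ _ _ _ Ha Hb Hd),
    (orient_comb _ _ _ _ _ _ _ _ _ _ _ _ Hc Hd Ha),
    (orient_comb _ _ _ _ _ _ _ _ _ _ _ _ Hc Hd Hb).
  set (D := orient u v w) in *.
  assert (HD2 : 0 < D * D) by nra.
  assert (E : forall p q, D * p * (D * q) < 0 <-> p * q < 0).
  { intros p q; replace (D * p * (D * q)) with ((D * D) * (p * q)) by ring.
    split; intros; nra. }
  rewrite !E; tauto.
Qed.

Lemma proper_cross_swap_right (a b c d : point) :
  proper_cross a b c d -> proper_cross a b d c.
Proof.
  unfold proper_cross.
  replace (orient d c a) with (- orient c d a) by (unfold orient; ring).
  replace (orient d c b) with (- orient c d b) by (unfold orient; ring).
  intros [H1 H2]; split; lra.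
Qed.

Lemma proper_cross_swap_left (a b c d : point) :
  proper_cross a b c d -> proper_cross b a c d.
Proof.
  unfold proper_cross.
  replace (orient b a c) with (- orient a b c) by (unfold orient; ring).
  replace (orient b a d) with (- orient a b d) by (unfold orient; ring).
  intros [H1 H2]; split; lra.
Qed.

(* A segment from a point d on the near side of the hypotenuse of the
   reference triangle (0,0), (1,0), (0,1) to a point c beyond it can only leave
   the triangle through one of the legs. *)
Lemma cross_hypotenuse (c2 c3 d2 d3 : R) :
  1 - c2 - c3 < 0 -> 0 < 1 - d2 - d3 ->
  orient (c2, c3) (d2, d3) (1, 0) * orient (c2, c3) (d2, d3) (0, 1) < 0 ->
  orient (c2, c3) (d2, d3) (0, 0) <> 0 ->
  d2 <> 0 -> d3 <> 0 ->
  ~ (0 < d2 /\ 0 < d3) ->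
  proper_cross (0, 0) (1, 0) (c2, c3) (d2, d3) \/
  proper_cross (0, 0) (0, 1) (c2, c3) (d2, d3).
Proof.
  unfold proper_cross.
  set (U := orient (c2, c3) (d2, d3) (0, 0)).
  set (V := orient (c2, c3) (d2, d3) (1, 0)).
  set (W := orient (c2, c3) (d2, d3) (0, 1)).
  assert (EU : U = c2 * d3 - c3 * d2) by (unfold U, orient; cbn; ring).
  assert (EV : V = c3 * (1 - d2 - d3) - (1 - c2 - c3) * d3) by (unfold V, orient; cbn; ring).
  assert (EW : W = (1 - c2 - c3) * d2 - c2 * (1 - d2 - d3)) by (unfold W, orient; cbn; ring).
  replace (orient (0, 0) (1, 0) (c2, c3)) with c3 by (unfold orient; cbn; ring).
  replace (orient (0, 0) (1, 0) (d2, d3)) with d3 by (unfold orient; cbn; ring).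
  replace (orient (0, 0) (0, 1) (c2, c3)) with (- c2) by (unfold orient; cbn; ring).
  replace (orient (0, 0) (0, 1) (d2, d3)) with (- d2) by (unfold orient; cbn; ring).
  clearbody U V W.
  intros Hc Hd HVW HU Hd2 Hd3 Hn.
  (* V - W = (1 - d2 - d3) - (1 - c2 - c3) > 0, which decides the two opposite signs. *)
  assert (HV : 0 < V /\ W < 0) by (destruct (Rlt_le_dec 0 V); nra).
  destruct HV as [HV HW].
  assert (Hdv : d3 < 0 -> 0 < c3) by (intros; nra).
  assert (Hdw : d2 < 0 -> 0 < c2) by (intros; nra).
  destruct (Rlt_le_dec d3 0) as [h3|h3].
  - specialize (Hdv h3).
    destruct (Rlt_le_dec U 0) as [hU|hU].
    + left; split; nra.
    + assert (0 < U) by lra. right.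
      assert (c2 * d2 < 0).
      { destruct (Rlt_le_dec d2 0) as [h2|h2]; [specialize (Hdw h2); nra|].
        assert (0 < d2) by lra. assert (c2 < 0) by nra. nra. }
      split; nra.
  - assert (0 < d3) by lra.
    assert (h2 : d2 < 0) by (apply Rnot_le_lt; intro; apply Hn; lra).
    specialize (Hdw h2).
    destruct (Rlt_le_dec 0 U) as [hU|hU].
    + right; split; nra.
    + assert (U < 0) by lra. left.
      assert (c3 < 0) by nra. split; nra.
Qed.

(** Orientation relative to a line is affine along a segment, so the crossing parameter is a ratio
    of orientations, and the strict sign change puts it inside (0,1). *)
Lemma proper_cross_point (a b c d : point) :
  proper_cross a b c d ->
  exists l t, 0 < l < 1 /\ 0 < t < 1 /\
    (1 - l) * fst c + l * fst d = (1 - t) * fst a + t * fst b /\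
    (1 - l) * snd c + l * snd d = (1 - t) * snd a + t * snd b.
Proof.
  intros [H1 H2].
  (* Both denominators are the cross product of b - a and d - c. *)
  assert (HE : orient a b d - orient a b c = orient c d a - orient c d b)
    by (unfold orient; ring).
  assert (R01 : forall p q, p * q < 0 -> p - q <> 0 /\ 0 < p / (p - q) < 1).
  { intros p q Hpq. assert (Hne : p - q <> 0) by nra. split; [exact Hne|].
    assert (Hsq : 0 < (p - q) * (p - q)) by nra.
    replace (p / (p - q)) with (p * (p - q) / ((p - q) * (p - q))) by (field; lra).
    split; [apply Rdiv_lt_0_compat; nra|].
    apply (Rmult_lt_reg_r ((p - q) * (p - q))); [exact Hsq|].
    field_simplify; [nra|lra]. }
  destruct (R01 _ _ H1) as [N1 L1]. destruct (R01 _ _ H2) as [N2 L2].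
  exists (orient a b c / (orient a b c - orient a b d)),
    (orient c d a / (orient c d a - orient c d b)).
  split; [exact L1|]. split; [exact L2|].
  assert (N3 : orient a b d - orient a b c <> 0) by lra.
  rewrite <- HE.
  split; field_simplify_eq; try (split; assumption); unfold orient; ring.
Qed.

(* z is a point of the triangle on the near side of the line from (1,0) through
   x; that side meets the boundary of the triangle only along its two legs, so a
   segment from z to a point c on the same side but not inside the triangle
   crosses one of them. *)
Lemma cross_leg (x2 x3 z2 z3 c2 c3 d2 d3 m : R) :
  0 < z2 -> 0 < z3 -> z2 + z3 < 1 -> 0 < m < 1 ->
  (1 - m) * c2 + m * d2 = z2 -> (1 - m) * c3 + m * d3 = z3 ->
  0 < x2 -> 0 < x3 -> x2 + x3 < 1 ->
  (1 - x2 - x3) * z3 < x3 * (1 - z2 - z3) ->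
  (1 - x2 - x3) * c3 < x3 * (1 - c2 - c3) ->
  c2 * z3 - c3 * z2 <> 0 -> c2 <> 0 -> c3 <> 0 ->
  ~ (0 < c2 /\ 0 < c3 /\ c2 + c3 < 1) ->
  proper_cross (0, 0) (1, 0) (c2, c3) (d2, d3) \/
  proper_cross (0, 0) (0, 1) (c2, c3) (d2, d3).
Proof.
  intros Hz2 Hz3 Hz1 Hm Ez2 Ez3 Hx2 Hx3 Hx1 Hrz Hrc HU0 Hc2 Hc3 Hn.
  unfold proper_cross.
  set (U := orient (c2, c3) (d2, d3) (0, 0)).
  set (V := orient (c2, c3) (d2, d3) (1, 0)).
  set (W := orient (c2, c3) (d2, d3) (0, 1)).
  replace (orient (0, 0) (1, 0) (c2, c3)) with c3 by (unfold orient; cbn; ring).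
  replace (orient (0, 0) (1, 0) (d2, d3)) with d3 by (unfold orient; cbn; ring).
  replace (orient (0, 0) (0, 1) (c2, c3)) with (- c2) by (unfold orient; cbn; ring).
  replace (orient (0, 0) (0, 1) (d2, d3)) with (- d2) by (unfold orient; cbn; ring).
  (* Since m (d - c) = z - c, scaling by m > 0 replaces d by z in the orientations relative to
     cd. *)
  assert (HmU : m * U = c2 * z3 - c3 * z2)
    by (unfold U, orient; cbn; rewrite <- Ez2, <- Ez3; ring).
  assert (HmV : m * V = c3 * (1 - z2 - z3) - (1 - c2 - c3) * z3)
    by (unfold V, orient; cbn; rewrite <- Ez2, <- Ez3; ring).
  assert (HmW : m * W = (1 - c2 - c3) * z2 - c2 * (1 - z2 - z3))
    by (unfold W, orient; cbn; rewrite <- Ez2, <- Ez3; ring).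
  clearbody U V W.
  assert (Hsg : forall a b, (m * a) * (m * b) < 0 -> a * b < 0).
  { clear - Hm. intros a b Hab. assert (0 < m * m) by nra. nra. }
  assert (Hs2 : c2 < 0 -> 0 < d2) by (clear - Hm Hz2 Ez2; intro; nra).
  assert (Hs3 : c3 < 0 -> 0 < d3) by (clear - Hm Hz3 Ez3; intro; nra).
  set (z1 := 1 - z2 - z3) in *. assert (Hz1' : 0 < z1) by (unfold z1; lra).
  set (c1 := 1 - c2 - c3) in *. set (x1 := 1 - x2 - x3) in *.
  assert (Hx1' : 0 < x1) by (unfold x1; lra).
  destruct (Rlt_le_dec c3 0) as [h3|h3].
  - specialize (Hs3 h3).
    assert (HV : m * V < 0).
    { rewrite HmV. clear - h3 Hrc Hrz Hx3 Hz3.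
      assert (z3 * (x1 * c3) < z3 * (x3 * c1)) by (apply Rmult_lt_compat_l; lra). nra. }
    destruct (Rlt_le_dec 0 (m * U)) as [hU|hU].
    + left; split; [clear - h3 Hs3; nra|apply Hsg; clear - hU HV; nra].
    + assert (HU : m * U < 0) by lra.
      assert (h2 : c2 < 0) by (clear - HU HmU h3 Hz2 Hz3; nra).
      specialize (Hs2 h2).
      right; split; [clear - h2 Hs2; nra|]. apply Hsg.
      cut (0 < m * W); [clear - HU; nra|]. rewrite HmW.
      assert (A1 : z2 * (c3 * z1) < z2 * (c1 * z3))
        by (apply Rmult_lt_compat_l; lra).
      assert (A2 : z1 * (c2 * z3) < z1 * (c3 * z2))
        by (apply Rmult_lt_compat_l; lra).
      clear - A1 A2 Hz3; nra.
  - assert (h3' : 0 < c3) by lra.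
    assert (H1 : 0 < c1) by (clear - h3' Hrc Hx1' Hx3; nra).
    assert (h2 : c2 < 0).
    { apply Rnot_le_lt; intro; apply Hn; unfold c1 in H1; lra. }
    specialize (Hs2 h2).
    right; split; [clear - h2 Hs2; nra|]. apply Hsg. rewrite HmU, HmW.
    assert (A1 : c2 * z3 - c3 * z2 < 0) by (clear - h2 h3' Hz2 Hz3; nra).
    assert (A2 : 0 < c1 * z2 - c2 * z1) by (clear - h2 H1 Hz2 Hz1'; nra).
    clear - A1 A2; nra.
Qed.

(** * Visibility inside a triangle *)

Definition clear (S : list (point * point)) (a b : point) : Prop :=
  forall c, In c S -> ~ proper_cross a b (fst c) (snd c).

Definition no_collinear (P : list point) : Prop :=
  forall a b c, In a P -> In b P -> In c P -> a <> b -> b <> c -> a <> c ->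
    orient a b c <> 0.

(** A constraint starting at u can cross vw without crossing uv or uw, so it has to be excluded
    separately. The condition holds when v and w share a subcone of u. *)
Definition no_fan (S : list (point * point)) (u v w : point) : Prop :=
  forall c b g, is_constraint S u c -> 0 < b -> 0 < g -> ~ comb u v w b g c.

Lemma clear_constraint (S : list (point * point)) (a b c d : point) :
  clear S a b -> is_constraint S c d -> ~ proper_cross a b c d.
Proof.
  intros H [Hc|Hc] Hx.
  - exact (H _ Hc Hx).
  - exact (H _ Hc (proper_cross_swap_right _ _ _ _ Hx)).
Qed.

Lemma clear_sym (S : list (point * point)) (a b : point) : clear S a b -> clear S b a.
Proof. intros H c Hc Hx. exact (H c Hc (proper_cross_swap_left _ _ _ _ Hx)). Qed.

(** Constraints do not cross each other, so the disjunct of [sees] for constraints adds nothing. *)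
Lemma sees_clear (P : list point) (S : list (point * point)) (a b : point) :
  valid_constraints P S -> sees S a b <-> clear S a b.
Proof.
  intros [_ HS]; split.
  - intros [[H|H]|H].
    + intros c Hc. exact (HS _ _ H Hc).
    + apply clear_sym. intros c Hc. exact (HS _ _ H Hc).
    + exact H.
  - intro H; right; exact H.
Qed.

Lemma constraint_in (P : list point) (S : list (point * point)) (a b : point) :
  valid_constraints P S -> is_constraint S a b -> In a P /\ In b P /\ a <> b.
Proof.
  intros [HS _] [H|H]; destruct (HS _ H) as (H1 & H2 & H3); cbn in *; auto.
Qed.

Lemma orient_legs (u v w c : point) (c2 c3 : R) :
  comb u v w c2 c3 c ->
  orient u v c = orient u v w * c3 /\ orient u w c = - orient u v w * c2 /\
  orient v w c = orient u v w * (1 - c2 - c3).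
Proof.
  intros Hc.
  rewrite (orient_comb _ _ _ _ _ _ _ _ _ _ _ _ (comb_origin u v w) (comb_left u v w) Hc),
    (orient_comb _ _ _ _ _ _ _ _ _ _ _ _ (comb_origin u v w) (comb_right u v w) Hc),
    (orient_comb _ _ _ _ _ _ _ _ _ _ _ _ (comb_left u v w) (comb_right u v w) Hc).
  replace (orient (0, 0) (1, 0) (c2, c3)) with c3 by (unfold orient; cbn; ring).
  replace (orient (0, 0) (0, 1) (c2, c3)) with (- c2) by (unfold orient; cbn; ring).
  replace (orient (1, 0) (0, 1) (c2, c3)) with (1 - c2 - c3) by (unfold orient; cbn; ring).
  repeat split; ring.
Qed.

Lemma orient_neq (a b c : point) : orient a b c <> 0 -> a <> b /\ b <> c /\ a <> c.
Proof.
  intros H; repeat split; intros ->; apply H; unfold orient; ring.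
Qed.

Lemma comb_nonzero (P : list point) (u v w c : point) (c2 c3 : R) :
  no_collinear P -> In u P -> In v P -> In w P -> In c P ->
  orient u v w <> 0 -> comb u v w c2 c3 c -> c <> u -> c <> v -> c <> w ->
  c2 <> 0 /\ c3 <> 0.
Proof.
  intros GP Iu Iv Iw Ic HD Hc Nu Nv Nw.
  destruct (orient_neq _ _ _ HD) as (N1 & N2 & N3).
  destruct (orient_legs _ _ _ _ _ _ Hc) as (E1 & E2 & _).
  split; intros ->.
  - apply (GP u w c); auto. rewrite E2; ring.
  - apply (GP u v c); auto. rewrite E1; ring.
Qed.

(** A constraint crossing vw has an end d on the side of u. If d is not u, emptiness and general
    position put d outside the triangle, so the constraint crosses uv or uw as well; if d = u, it
    contradicts [no_fan]. *)
Lemma empty_triangle_clear (P : list point) (S : list (point * point)) (u v w : point) :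
  no_collinear P -> valid_constraints P S ->
  In u P -> In v P -> In w P -> orient u v w <> 0 ->
  clear S u v -> clear S u w -> no_fan S u v w ->
  (forall y, In y P -> ~ inside u v w y) ->
  clear S v w.
Proof.
  intros GP HS Iu Iv Iw HD Cv Cw NF NI.
  assert (Main : forall c d c2 c3 d2 d3, is_constraint S c d ->
    comb u v w c2 c3 c -> comb u v w d2 d3 d -> 1 - c2 - c3 < 0 -> 0 < 1 - d2 - d3 ->
    ~ proper_cross v w c d).
  { intros c d c2 c3 d2 d3 Hcd Hc Hd Hc1 Hd1 Hx.
    destruct (constraint_in _ _ _ _ HS Hcd) as (Ic & Id & Ncd).
    apply (proper_cross_comb _ _ _ _ _ _ _ _ _ _ _ _ _ _ _ HD
      (comb_left u v w) (comb_right u v w) Hc Hd) in Hx.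
    destruct Hx as [_ Hx].
    destruct (orient_legs _ _ _ _ _ _ Hc) as (_ & _ & Ec).
    destruct (orient_legs _ _ _ _ _ _ Hd) as (_ & _ & Ed).
    assert (Nc : orient v w c <> 0) by (rewrite Ec; apply Rmult_integral_contrapositive; lra).
    assert (Nd : orient v w d <> 0) by (rewrite Ed; apply Rmult_integral_contrapositive; lra).
    apply orient_neq in Nc; apply orient_neq in Nd.
    destruct (orient_neq _ _ _ HD) as (N1 & N2 & N3).
    destruct (excluded_middle_informative (d = u)) as [->|Ndu].
    - destruct (orient_legs _ _ _ _ _ _ Hd) as (F1 & F2 & _).
      assert (orient u v u = 0) by (unfold orient; ring).
      assert (orient u w u = 0) by (unfold orient; ring).
      assert (d2 = 0) by (destruct (Rmult_integral (- orient u v w) d2); lra).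
      assert (d3 = 0) by (destruct (Rmult_integral (orient u v w) d3); lra). subst d2 d3.
      unfold orient in Hx; cbn in Hx.
      apply (NF c c2 c3); auto.
      + destruct Hcd as [Hcd|Hcd]; [right|left]; exact Hcd.
      + nra.
      + nra.
    - assert (Ncu : c <> u).
      { intros ->. replace (orient v w u) with (orient u v w) in Ec by (unfold orient; ring).
        assert (1 = 1 - c2 - c3) by (apply (Rmult_eq_reg_l (orient u v w)); lra). lra. }
      destruct (comb_nonzero P u v w d d2 d3) as [D2 D3]; auto; try (intros ->; tauto).
      destruct (cross_hypotenuse c2 c3 d2 d3) as [X|X]; auto.
      + intro E. apply (GP c d u); auto.
        rewrite (orient_comb _ _ _ _ _ _ _ _ _ _ _ _ Hc Hd (comb_origin u v w)), E. ring.
      + intros [P2 P3]. apply (NI d Id). exists d2, d3; repeat split; try lra; apply Hd.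
      + apply (clear_constraint _ _ _ _ _ Cv Hcd).
        apply (proper_cross_comb _ _ _ _ _ _ _ _ _ _ _ _ _ _ _ HD
          (comb_origin u v w) (comb_left u v w) Hc Hd); exact X.
      + apply (clear_constraint _ _ _ _ _ Cw Hcd).
        apply (proper_cross_comb _ _ _ _ _ _ _ _ _ _ _ _ _ _ _ HD
          (comb_origin u v w) (comb_right u v w) Hc Hd); exact X. }
  intros [c d] Hin Hx; cbn [fst snd] in Hx.
  destruct (comb_exists u v w c HD) as (c2 & c3 & Hc).
  destruct (comb_exists u v w d HD) as (d2 & d3 & Hd).
  pose proof Hx as [Hs _].
  destruct (orient_legs _ _ _ _ _ _ Hc) as (_ & _ & Ec).
  destruct (orient_legs _ _ _ _ _ _ Hd) as (_ & _ & Ed).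
  rewrite Ec, Ed in Hs.
  assert (Hs' : (1 - c2 - c3) * (1 - d2 - d3) < 0).
  { assert (0 < orient u v w * orient u v w) by nra. nra. }
  clear Hs Ec Ed.
  destruct (Rlt_le_dec (1 - c2 - c3) 0).
  - apply (Main c d c2 c3 d2 d3); auto; [left; exact Hin|nra].
  - assert (1 - d2 - d3 < 0) by nra.
    apply (Main d c d2 d3 c2 c3); auto; [right; exact Hin|nra|].
    apply proper_cross_swap_right; exact Hx.
Qed.

(* Among the points inside the triangle, x is the one with the smallest angle
   at v measured from the side vu. *)
Lemma first_hull_point_clear (P : list point) (S : list (point * point))
  (u v w x : point) (x2 x3 : R) :
  no_collinear P -> valid_constraints P S ->
  In u P -> In v P -> In w P -> orient u v w <> 0 ->
  clear S u v -> clear S u w ->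
  0 < x2 -> 0 < x3 -> x2 + x3 < 1 -> comb u v w x2 x3 x ->
  (forall y b g, In y P -> 0 < b -> 0 < g -> b + g < 1 -> comb u v w b g y ->
     x3 * (1 - b - g) <= (1 - x2 - x3) * g) ->
  clear S u x.
Proof.
  intros GP HS Iu Iv Iw HD Cv Cw Hx2 Hx3 Hx1 Hx Hmin.
  (* The constraint crosses ux at t x, and c is its end strictly on the side of u of the line vx; by
     minimality of x, c cannot be inside the triangle. *)
  assert (Main : forall c d c2 c3 d2 d3 m t, is_constraint S c d ->
    comb u v w c2 c3 c -> comb u v w d2 d3 d -> 0 < m < 1 -> 0 < t < 1 ->
    (1 - m) * c2 + m * d2 = t * x2 -> (1 - m) * c3 + m * d3 = t * x3 ->
    orient c d u <> 0 ->
    (1 - x2 - x3) * c3 < x3 * (1 - c2 - c3) -> False).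
  { intros c d c2 c3 d2 d3 m t Hcd Hc Hd Hm Ht E2 E3 HU Hr.
    destruct (constraint_in _ _ _ _ HS Hcd) as (Ic & Id & Ncd).
    destruct (orient_neq _ _ _ HU) as (_ & _ & Ncu).
    destruct (orient_legs _ _ _ _ _ _ Hc) as (F1 & F2 & F3).
    assert (Z : forall a, 0 = orient u v w * a -> a = 0).
    { intros a Ha. symmetry in Ha. apply Rmult_integral in Ha. tauto. }
    assert (Ncv : c <> v).
    { intros ->. replace (orient u v v) with 0 in F1 by (unfold orient; ring).
      replace (orient v w v) with 0 in F3 by (unfold orient; ring).
      apply Z in F1; apply Z in F3. rewrite F3, F1 in Hr. lra. }
    assert (Ncw : c <> w).
    { intros ->. replace (orient u v w) with (orient u v w * 1) in F1 at 1 by ring.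
      apply Rmult_eq_reg_l in F1; [|exact HD].
      replace (orient v w w) with 0 in F3 by (unfold orient; ring).
      apply Z in F3. rewrite F3, <- F1 in Hr. lra. }
    destruct (comb_nonzero P u v w c c2 c3) as [C2 C3]; auto.
    rewrite (orient_comb _ _ _ _ _ _ _ _ _ _ _ _ Hc Hd (comb_origin u v w)) in HU.
    destruct (cross_leg x2 x3 (t * x2) (t * x3) c2 c3 d2 d3 m) as [X|X]; auto;
      try (clear - Ht Hx2 Hx3 Hx1; nra).
    - rewrite <- E2, <- E3. intro E. apply HU. apply Rmult_eq_0_compat_l.
      apply (Rmult_eq_reg_l m); [|lra]. unfold orient; cbn. lra.
    - intros (B1 & B2 & B3). specialize (Hmin c c2 c3 Ic B1 B2 B3 Hc). lra.
    - apply (clear_constraint _ _ _ _ _ Cv Hcd).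
      apply (proper_cross_comb _ _ _ _ _ _ _ _ _ _ _ _ _ _ _ HD
        (comb_origin u v w) (comb_left u v w) Hc Hd); exact X.
    - apply (clear_constraint _ _ _ _ _ Cw Hcd).
      apply (proper_cross_comb _ _ _ _ _ _ _ _ _ _ _ _ _ _ _ HD
        (comb_origin u v w) (comb_right u v w) Hc Hd); exact X. }
  intros [c d] Hin HX; cbn [fst snd] in HX.
  destruct (comb_exists u v w c HD) as (c2 & c3 & Hc).
  destruct (comb_exists u v w d HD) as (d2 & d3 & Hd).
  assert (HU : orient c d u <> 0) by (destruct HX as [_ HX]; intro E; rewrite E in HX; lra).
  apply (proper_cross_comb _ _ _ _ _ _ _ _ _ _ _ _ _ _ _ HD
    (comb_origin u v w) Hx Hc Hd) in HX.
  destruct (proper_cross_point _ _ _ _ HX) as (m & t & Hm & Ht & E2 & E3); cbn in E2, E3.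
  destruct (Rlt_le_dec ((1 - x2 - x3) * c3) (x3 * (1 - c2 - c3))) as [Lc|Lc].
  { apply (Main c d c2 c3 d2 d3 m t); auto; [left; exact Hin|lra|lra]. }
  destruct (Rlt_le_dec ((1 - x2 - x3) * d3) (x3 * (1 - d2 - d3))) as [Ld|Ld].
  { apply (Main d c d2 d3 c2 c3 (1 - m) t); auto; [right; exact Hin|lra|lra|lra|].
    replace (orient d c u) with (- orient c d u) by (unfold orient; ring). lra. }
  (* Neither end is strictly on the side of u of the line vx, so neither is the crossing point t x;
     but t < 1 puts it strictly on that side. *)
  assert (L1 : (1 - m) * (x3 * (1 - c2 - c3)) <= (1 - m) * ((1 - x2 - x3) * c3))
    by (apply Rmult_le_compat_l; lra).
  assert (L2 : m * (x3 * (1 - d2 - d3)) <= m * ((1 - x2 - x3) * d3))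
    by (apply Rmult_le_compat_l; lra).
  assert (L3 : x3 * (1 - t * x2 - t * x3) <= (1 - x2 - x3) * (t * x3)).
  { replace (t * x2) with ((1 - m) * c2 + m * d2) by lra.
    replace (t * x3) with ((1 - m) * c3 + m * d3) by lra. lra. }
  clear - L3 Ht Hx3. nra.
Qed.

(** * Minimisers and counting on finite lists *)

Lemma list_argmin (A : Type) (f : A -> R) (Q : A -> Prop) (l : list A) :
  (exists a, In a l /\ Q a) ->
  exists a, In a l /\ Q a /\ forall b, In b l -> Q b -> f a <= f b.
Proof.
  induction l as [|a l IH]; intros [a0 [H0 Q0]]; [destruct H0|].
  destruct (classic (exists a, In a l /\ Q a)) as [Hl|Hl].
  - destruct (IH Hl) as (m & Im & Qm & Hm).
    destruct (classic (Q a /\ f a <= f m)) as [[Qa La]|Na].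
    + exists a; repeat split; [left; reflexivity|exact Qa|].
      intros b [<-|Hb] Qb; [lra|]. specialize (Hm b Hb Qb); lra.
    + exists m; repeat split; [right; exact Im|exact Qm|].
      intros b [<-|Hb] Qb; [|exact (Hm b Hb Qb)].
      destruct (Rle_lt_dec (f m) (f a)); [assumption|].
      exfalso; apply Na; split; [exact Qb|lra].
  - assert (a0 = a) as ->.
    { destruct H0 as [H0|H0]; [auto|]. exfalso; apply Hl; exists a0; auto. }
    exists a; repeat split; [left; reflexivity|exact Q0|].
    intros b [<-|Hb] Qb; [lra|]. exfalso; apply Hl; exists b; auto.
Qed.

(** The predicates concern real numbers, hence the classical case distinction. The counts are the
    measures of the inductions on hull chains and on distances. *)
Fixpoint count (A : Type) (Q : A -> Prop) (l : list A) : nat :=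
  match l with
  | nil => 0
  | a :: l' => (if excluded_middle_informative (Q a) then 1 else 0) + count A Q l'
  end.

Lemma count_le (A : Type) (Q Q' : A -> Prop) (l : list A) :
  (forall a, In a l -> Q a -> Q' a) -> (count A Q l <= count A Q' l)%nat.
Proof.
  induction l as [|a l IH]; intros H; cbn; [lia|].
  assert (count A Q l <= count A Q' l)%nat by (apply IH; intros; apply H; cbn; auto).
  destruct (excluded_middle_informative (Q a)) as [q|q];
    destruct (excluded_middle_informative (Q' a)) as [q'|q']; try lia.
  exfalso; apply q', H; cbn; auto.
Qed.

Lemma count_lt (A : Type) (Q Q' : A -> Prop) (l : list A) (x : A) :
  (forall a, In a l -> Q a -> Q' a) -> In x l -> Q' x -> ~ Q x ->
  (count A Q l < count A Q' l)%nat.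
Proof.
  induction l as [|a l IH]; intros H Hx Hx' Nx; [destruct Hx|].
  cbn [count].
  assert (Hle : (count A Q l <= count A Q' l)%nat)
    by (apply count_le; intros; apply H; cbn; auto).
  destruct Hx as [->|Hx].
  - destruct (excluded_middle_informative (Q x)); [contradiction|].
    destruct (excluded_middle_informative (Q' x)); [lia|contradiction].
  - assert (count A Q l < count A Q' l)%nat by (apply IH; auto; intros; apply H; cbn; auto).
    destruct (excluded_middle_informative (Q a)) as [q|q];
      destruct (excluded_middle_informative (Q' a)) as [q'|q']; try lia.
    exfalso; apply q', H; cbn; auto.
Qed.

(** * Gift wrapping *)

Lemma inside_shrink (u v w x y : point) :
  inside u v w x -> inside u x w y -> inside u v w y.
Proof.
  intros (b & g & Hb & Hg & Hbg & Hx) (l & m & Hl & Hm & Hlm & Hy).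
  exists (l * b), (l * g + m). repeat split; try nra;
    apply (comb_compose _ _ _ _ _ _ _ _ _ Hx Hy).
Qed.

Lemma not_inside_vertex (u x w : point) : orient u x w <> 0 -> ~ inside u x w x.
Proof.
  intros HD (b & g & Hb & Hg & Hbg & Hx).
  destruct (orient_legs _ _ _ _ _ _ Hx) as (E & _ & _).
  replace (orient u x x) with 0 in E by (unfold orient; ring).
  symmetry in E; apply Rmult_integral in E; lra.
Qed.

(* One step of gift wrapping: vx is the first edge of the hull of the points in
   the triangle as seen from u; by convexity the later edges turn away from it
   towards the direction of uw, which is what the last clause records. *)
Lemma hull_step (P : list point) (S : list (point * point)) (u v w : point) :
  no_collinear P -> valid_constraints P S ->
  In u P -> In v P -> In w P -> orient u v w <> 0 ->
  clear S u v -> clear S u w -> no_fan S u v w ->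
  clear S v w \/
  exists x b g, In x P /\ 0 < b /\ 0 < g /\ b + g < 1 /\ comb u v w b g x /\
    clear S u x /\ clear S v x /\ orient u x w <> 0 /\ no_fan S u x w /\
    forall y, In y P -> y = w \/ inside u x w y ->
      exists l m, 0 < l /\ 0 <= m /\
        fst y - fst x = l * (fst x - fst v) + m * (fst w - fst u) /\
        snd y - snd x = l * (snd x - snd v) + m * (snd w - snd u).
Proof.
  intros GP HS Iu Iv Iw HD Cv Cw NF.
  destruct (classic (exists y, In y P /\ inside u v w y)) as [Hex|Hno].
  2: { left. apply (empty_triangle_clear P S u); auto.
       intros y Iy Hy; apply Hno; exists y; auto. }
  right.
  (* The ratio equals g / (1 - b - g) in the coordinates of y, which grows with the angle at v
     measured from vu. *)
  destruct (list_argmin _ (fun y => orient u v y / orient v w y) _ _ Hex)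
    as (x & Ix & (b & g & Hb & Hg & Hbg & Hx) & Hmin).
  assert (Hm : forall y l m, In y P -> 0 < l -> 0 < m -> l + m < 1 -> comb u v w l m y ->
    g * (1 - l - m) <= (1 - b - g) * m).
  { intros y l m Iy Hl Hm Hlm Hy.
    assert (Hr := Hmin y Iy (ex_intro _ l (ex_intro _ m (conj Hl (conj Hm (conj Hlm Hy)))))).
    destruct (orient_legs _ _ _ _ _ _ Hx) as (E1 & _ & E2).
    destruct (orient_legs _ _ _ _ _ _ Hy) as (E3 & _ & E4).
    cbn beta in Hr. rewrite E1, E2, E3, E4 in Hr.
    replace (orient u v w * g / (orient u v w * (1 - b - g))) with (g / (1 - b - g)) in Hr
      by (field; lra).
    replace (orient u v w * m / (orient u v w * (1 - l - m))) with (m / (1 - l - m)) in Hr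
      by (field; lra).
    apply (Rmult_le_compat_r ((1 - b - g) * (1 - l - m))) in Hr; [|clear - Hbg Hlm; nra].
    replace (g / (1 - b - g) * ((1 - b - g) * (1 - l - m))) with (g * (1 - l - m)) in Hr
      by (field; lra).
    replace (m / (1 - l - m) * ((1 - b - g) * (1 - l - m))) with ((1 - b - g) * m) in Hr
      by (field; lra).
    exact Hr. }
  assert (Cx : clear S u x) by (apply (first_hull_point_clear P S u v w x b g); auto).
  destruct (orient_legs _ _ _ _ _ _ Hx) as (E1 & E2 & _).
  assert (D1 : orient u v x <> 0)
    by (rewrite E1; apply Rmult_integral_contrapositive; split; lra).
  assert (D2 : orient u x w <> 0).
  { replace (orient u x w) with (- orient u w x) by (unfold orient; ring).
    rewrite E2. apply Ropp_neq_0_compat, Rmult_integral_contrapositive; split; lra. }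
  exists x, b, g. do 6 (split; [assumption|]).
  split; [|split; [exact D2|split]].
  (* A point inside u v x would have a smaller angle at v than x. *)
  - apply (empty_triangle_clear P S u v x); auto.
    + intros c l m Hc Hl Hm' Hcb.
      apply (NF c (l + m * b) (m * g) Hc); [nra|nra|].
      apply (comb_compose_left _ _ _ _ _ _ _ _ _ Hx Hcb).
    + intros y Iy (l & m & Hl & Hm' & Hlm & Hy).
      assert (Hmg : 0 < m * g) by nra.
      assert (Hmb : 0 < m * b) by nra.
      assert (Hr := Hm y (l + m * b) (m * g) Iy ltac:(lra) Hmg ltac:(nra)
        (comb_compose_left _ _ _ _ _ _ _ _ _ Hx Hy)).
      clear - Hr Hg Hlm Hm'. nra.
  - intros c l m Hc Hl Hm' Hcb.
    apply (NF c (l * b) (l * g + m) Hc); [nra|nra|].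
    apply (comb_compose _ _ _ _ _ _ _ _ _ Hx Hcb).
  - intros y Iy Hy.
    assert (Hc : exists y2 y3, comb u v w y2 y3 y /\ y2 < b /\
      g * (1 - y2 - y3) <= (1 - b - g) * y3).
    { destruct Hy as [->|Hy].
      - exists 0, 1. split; [apply comb_right|]. split; lra.
      - pose proof Hy as (l & m & Hl & Hm' & Hlm & Hy').
        assert (Hbg' : inside u v w x) by (exists b, g; auto).
        exists (l * b), (l * g + m).
        pose proof (comb_compose _ _ _ _ _ _ _ _ _ Hx Hy') as Hc.
        split; [exact Hc|]. split; [nra|].
        apply (Hm y); auto; nra. }
    destruct Hc as (y2 & y3 & [Y1 Y2] & Hlt & Hr). destruct Hx as [X1 X2].
    (* The v-coordinate of y - x = l (x - v) + m (w - u) forces l, and the w-coordinate then forces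
       m; m >= 0 is the minimality of x. *)
    exists ((b - y2) / (1 - b)), ((b - y2) / (1 - b) * (1 - b - g) + (1 - b - g) - (1 - y2 - y3)).
    split; [apply Rdiv_lt_0_compat; lra|]. split; [|split].
    + apply (Rmult_le_reg_r (1 - b)); [lra|]. field_simplify; [|lra]. lra.
    + replace (fst y - fst x) with ((fst y - fst u) - (fst x - fst u)) by ring.
      replace (fst x - fst v) with ((fst x - fst u) - (fst v - fst u)) by ring.
      rewrite Y1, X1. field; lra.
    + replace (snd y - snd x) with ((snd y - snd u) - (snd x - snd u)) by ring.
      replace (snd x - snd v) with ((snd x - snd u) - (snd v - snd u)) by ring.
      rewrite Y2, X2. field; lra.
Qed.

(** * Paths of bounded length *)

Definition reach (k x : nat) (P : list point) (S : list (point * point))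
  (a b : point) (d : R) : Prop :=
  exists l, is_path k x P S a l b /\ path_len a l <= d.

Lemma reach_le (k x : nat) P S a b d d' :
  reach k x P S a b d -> d <= d' -> reach k x P S a b d'.
Proof. intros (l & Hl & Hd) H; exists l; split; [exact Hl|lra]. Qed.

Lemma reach_edge (k x : nat) P S a b :
  theta_edge k x P S a b -> reach k x P S a b (edist a b).
Proof.
  intros H; exists (b :: nil); split; cbn; [split; [exact H|reflexivity]|lra].
Qed.

Lemma reach_trans (k x : nat) P S a b c d e :
  reach k x P S a b d -> reach k x P S b c e -> reach k x P S a c (d + e).
Proof.
  intros (l & Hl & Hd) (l' & Hl' & He); exists (l ++ l').
  revert a d Hl Hd; induction l as [|p l IH]; cbn; intros a d Hl Hd.
  - subst b; split; [exact Hl'|lra].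
  - destruct Hl as [Hp Hl].
    destruct (IH p (d - edist a p) Hl) as [H1 H2]; [lra|].
    split; [split; assumption|lra].
Qed.

Lemma edist_sym (a b : point) : edist a b = edist b a.
Proof. unfold edist; f_equal; ring. Qed.

Lemma reach_sym (k x : nat) P S a b d :
  reach k x P S a b d -> reach k x P S b a d.
Proof.
  intros (l & Hl & Hd).
  apply (reach_le _ _ _ _ _ _ (path_len a l)); [|exact Hd]. clear Hd.
  revert a Hl; induction l as [|p l IH]; cbn; intros a Hl.
  - subst b; exists nil; cbn; split; [reflexivity|lra].
  - destruct Hl as [Hp Hl].
    rewrite Rplus_comm. apply (reach_trans _ _ _ _ _ p).
    + apply IH; exact Hl.
    + rewrite edist_sym. apply reach_edge.
      destruct Hp as [Hp|Hp]; [right|left]; exact Hp.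
Qed.

(** * Lengths along the hull chain *)

(* Here v and w are two vectors in a cone of half-angle atan t < pi/6. *)
Lemma chord_short_real (hv sv hw sw b g t : R) :
  0 < hv -> 0 < hw -> - (t * hv) <= sv <= t * hv -> - (t * hw) <= sw <= t * hw ->
  0 <= t -> 3 * (t * t) < 1 ->
  0 <= b -> 0 < g -> b + g <= 1 -> 0 < b * hv + g * hw - hv ->
  (b * hv + g * hw - hv) ^ 2 + (b * sv + g * sw - sv) ^ 2 < hw ^ 2 + sw ^ 2.
Proof.
  intros Hhv Hhw Hsv Hsw Ht Ht3 Hb Hg Hbg Hup.
  set (a := 1 - b). assert (Ha : 0 < a) by (unfold a; lra).
  replace (b * hv + g * hw - hv) with (g * hw - a * hv) in * by (unfold a; ring).
  replace (b * sv + g * sw - sv) with (g * sw - a * sv) by (unfold a; ring).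
  assert (Hsv2 : sv * sv <= t * t * (hv * hv)) by (clear - Hsv Hhv Ht; nra).
  assert (Hsvw : - (t * t * (hv * hw)) <= sv * sw).
  { assert (Hp : 0 <= t * hv) by nra. assert (Hq : 0 <= t * hw) by nra.
    clear - Hsv Hsw Hp Hq. nra. }
  assert (Hvw : 0 < hv * hw) by nra.
  assert (Hga : 0 < g * a) by nra.
  (* In the expansion of |g w - a v|^2, a hv < g hw bounds |a v|^2 by g a hv hw (1 + t^2), while the
     mixed term removes at least 2 g a hv hw (1 - t^2). The balance is negative since 3 t^2 < 1. *)
  assert (A1 : a * a * (hv * hv + sv * sv) <= g * a * (hv * hw) * (1 + t * t)).
  { apply Rle_trans with (a * a * (hv * hv) * (1 + t * t)).
    - assert (0 <= a * a) by nra. nra.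
    - apply Rmult_le_compat_r; [nra|].
      replace (a * a * (hv * hv)) with (a * hv * (a * hv)) by ring.
      replace (g * a * (hv * hw)) with (a * hv * (g * hw)) by ring.
      apply Rmult_le_compat_l; [nra|lra]. }
  assert (A2 : g * a * (hv * hw) * (1 - t * t) <= g * a * (hv * hw + sv * sw)).
  { rewrite Rmult_assoc. apply Rmult_le_compat_l; lra. }
  assert (A3 : 0 < g * a * (hv * hw)) by nra.
  assert (A4 : g * g * (hw * hw + sw * sw) <= hw * hw + sw * sw).
  { assert (0 <= hw * hw + sw * sw) by nra. assert (g * g <= 1) by nra. nra. }
  assert (A5 : g * a * (hv * hw) * (3 * (t * t)) < g * a * (hv * hw) * 1)
    by (apply Rmult_lt_compat_l; lra).
  clear - A1 A2 A4 A5. nra.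
Qed.

Section Chain.

Variables (k n : nat) (P : list point) (S : list (point * point)) (u w : point).
Variables (hx hy sx sy A B t : R).

(** The frame is left abstract so that the lateral coordinate can be reflected: only chains to the
    left of uw need treatment. *)
Let h (p : point) : R := hx * fst p + hy * snd p.
Let s (p : point) : R := sx * fst p + sy * snd p.

Hypothesis GP : no_collinear P.
Hypothesis HS : valid_constraints P S.
Hypothesis Iu : In u P.
Hypothesis Iw : In w P.
Hypothesis Cw : clear S u w.
Hypothesis Hframe : forall p q, edist p q = sqrt ((h q - h p) ^ 2 + (s q - s p) ^ 2).
Hypothesis Ht : 0 <= t.
Hypothesis Ht3 : 3 * (t * t) < 1.
Hypothesis HB : 0 <= B.
Hypothesis Hhw : 0 < h w - h u.
Hypothesis Hsw : - (t * (h w - h u)) <= s w - s u <= t * (h w - h u).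

(** This is what the induction on |uw| supplies for upward visibility edges, whichever cone they lie
    in. *)
Hypothesis Hedge : forall p q, In p P -> In q P -> clear S p q ->
  0 < h q - h p -> edist p q < edist u w ->
  reach k n P S p q (A * (h q - h p) + B * Rabs (s q - s p)).

Let in_wedge (v : point) : Prop :=
  0 < h v - h u /\ - (t * (h v - h u)) <= s v - s u <= t * (h v - h u).

(** The invariant of the current hull vertex during gift wrapping. *)
Let ready (v : point) : Prop :=
  In v P /\ orient u v w <> 0 /\ clear S u v /\ no_fan S u v w /\ in_wedge v.

Lemma linear_comb (v y : point) (b g : R) : comb u v w b g y ->
  h y - h u = b * (h v - h u) + g * (h w - h u) /\
  s y - s u = b * (s v - s u) + g * (s w - s u).
Proof.
  intros [H1 H2]; unfold h, s; split.
  - transitivity (hx * (fst y - fst u) + hy * (snd y - snd u)); [ring|].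
    rewrite H1, H2; ring.
  - transitivity (sx * (fst y - fst u) + sy * (snd y - snd u)); [ring|].
    rewrite H1, H2; ring.
Qed.

Lemma linear_turn (v x y : point) (l m : R) :
  fst y - fst x = l * (fst x - fst v) + m * (fst w - fst u) ->
  snd y - snd x = l * (snd x - snd v) + m * (snd w - snd u) ->
  h y - h x = l * (h x - h v) + m * (h w - h u) /\
  s y - s x = l * (s x - s v) + m * (s w - s u).
Proof.
  intros H1 H2; unfold h, s; split.
  - transitivity (hx * (fst y - fst x) + hy * (snd y - snd x)); [ring|].
    rewrite H1, H2; ring.
  - transitivity (sx * (fst y - fst x) + sy * (snd y - snd x)); [ring|].
    rewrite H1, H2; ring.
Qed.

Lemma chord_short (v y : point) (b g : R) :
  in_wedge v -> 0 <= b -> 0 < g -> b + g <= 1 -> comb u v w b g y ->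
  0 < h y - h v -> edist v y < edist u w.
Proof.
  intros [Hv Hsv] Hb Hg Hbg Hy Hup.
  destruct (linear_comb _ _ _ _ Hy) as [E1 E2].
  rewrite !Hframe. apply sqrt_lt_1_alt.
  split; [apply Rplus_le_le_0_compat; apply pow2_ge_0|].
  replace (h y - h v) with ((h y - h u) - (h v - h u)) in * by ring.
  replace (s y - s v) with ((s y - s u) - (s v - s u)) by ring.
  rewrite E1 in *. rewrite E2.
  apply (chord_short_real _ _ _ _ _ _ t); auto.
Qed.

Lemma in_wedge_comb (v x : point) (b g : R) :
  in_wedge v -> 0 < b -> 0 < g -> comb u v w b g x -> in_wedge x.
Proof.
  intros [Hv Hsv] Hb Hg Hx. destruct (linear_comb _ _ _ _ Hx) as [E1 E2].
  unfold in_wedge; rewrite E1, E2. split; [nra|split; nra].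
Qed.

(** By [hull_step], y - x is a positive multiple of x - v plus a nonnegative multiple of w - u: it
    goes up because both do, and left when both do. The count drops because x is inside u v w but
    not inside u x w. *)
Lemma chain_step (v : point) :
  ready v ->
  (forall y, In y P -> y = w \/ (inside u v w y /\ clear S u y) -> 0 < h y - h v) ->
  reach k n P S v w (A * (h w - h v) + B * Rabs (s w - s v)) \/
  exists x, ready x /\ inside u v w x /\ clear S u x /\
    (count _ (inside u x w) P < count _ (inside u v w) P)%nat /\
    reach k n P S v x (A * (h x - h v) + B * Rabs (s x - s v)) /\
    (forall y, In y P -> y = w \/ (inside u x w y /\ clear S u y) ->
      0 < h y - h x /\ (s x - s v <= 0 -> s w - s u <= 0 -> s y - s x <= 0)).
Proof.
  intros (Iv & HD & Cv & NF & Hw) Hup.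
  destruct (hull_step P S u v w)
    as [Hc|(x & b & g & Ix & Hb & Hg & Hbg & Hx & Cx & Cvx & Dx & NFx & Hturn)]; auto.
  - left. apply Hedge; auto.
    apply (chord_short v w 0 1); auto; try lra. apply comb_right.
  - right. exists x.
    assert (Inx : inside u v w x) by (exists b, g; auto).
    assert (Hupx : 0 < h x - h v) by (apply Hup; auto).
    split; [|split; [exact Inx|split; [exact Cx|split; [|split]]]].
    + repeat split; auto; apply (in_wedge_comb v x b g); auto.
    + apply (count_lt _ _ _ _ x); auto.
      * intros a _ Ha. exact (inside_shrink _ _ _ _ _ Inx Ha).
      * apply not_inside_vertex; exact Dx.
    + apply Hedge; auto. apply (chord_short v x b g); auto; lra.
    + intros y Iy Hy.
      destruct (Hturn y Iy) as (l & m & Hl & Hm & T1 & T2); [tauto|].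
      destruct (linear_turn _ _ _ _ _ T1 T2) as [E1 E2].
      rewrite E1, E2. split; [nra|intros; nra].
Qed.

(** Once an edge goes left and uw leans left, turning keeps all later edges going left, so the
    absolute values have one sign and the sum telescopes. *)
Lemma chain_left (N : nat) : forall v,
  (count _ (inside u v w) P < N)%nat -> ready v -> s w - s u <= 0 ->
  (forall y, In y P -> y = w \/ (inside u v w y /\ clear S u y) ->
     0 < h y - h v /\ s y - s v <= 0) ->
  reach k n P S v w (A * (h w - h v) - B * (s w - s v)).
Proof.
  induction N as [|N IH]; intros v HN Hv Hs Hup; [lia|].
  destruct (chain_step v Hv) as [Hr|(x & Hx & Inx & Cx & Hc & Hr & Hnext)].
  - intros y Iy Hy; apply (Hup y Iy Hy).
  - apply (reach_le _ _ _ _ _ _ _ _ Hr). rewrite Rabs_left1; [lra|].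
    apply Hup; auto.
  - assert (Hsx : s x - s v <= 0) by (apply Hup; [apply Hx|auto]).
    assert (Hr' : reach k n P S x w (A * (h w - h x) - B * (s w - s x))).
    { apply IH; auto; [lia|]. intros y Iy Hy. destruct (Hnext y Iy Hy); auto. }
    rewrite Rabs_left1 in Hr by exact Hsx.
    apply (reach_le _ _ _ _ _ _ _ _ (reach_trans _ _ _ _ _ _ _ _ _ Hr Hr')). lra.
Qed.

(** Edges to the right telescope against the term in s v - s u. At the first edge to the left, v and
    w satisfy s <= s u, so [chain_left] takes over and the sign changes only help. *)
Lemma chain_bound (N : nat) : forall v,
  (count _ (inside u v w) P < N)%nat -> ready v ->
  (s v - s u) * (h w - h u) < (s w - s u) * (h v - h u) ->
  (forall y, In y P -> y = w \/ (inside u v w y /\ clear S u y) -> 0 < h y - h v) ->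
  reach k n P S v w
    (A * (h w - h v) + B * Rabs (s w - s u) - B * (s v - s u)).
Proof.
  induction N as [|N IH]; intros v HN Hv Hside Hup; [lia|].
  pose proof (Rle_abs (s w - s u)) as Habs.
  pose proof Hv as (_ & _ & _ & _ & Hhv & Hsv).
  assert (Hwv : 0 < h w - h v) by (apply Hup; auto).
  destruct (chain_step v Hv Hup) as [Hr|(x & Hx & Inx & Cx & Hc & Hr & Hnext)].
  - apply (reach_le _ _ _ _ _ _ _ _ Hr).
    destruct (Rle_lt_dec 0 (s w - s v)) as [Hr0|Hl0].
    + rewrite (Rabs_right (s w - s v)) by lra. nra.
    + rewrite (Rabs_left (s w - s v)) by lra.
      assert (Hv0 : s v - s u <= 0).
      { apply Rnot_lt_le; intro Hpos. clear - Hpos Hl0 Hside Hwv Hhv.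
        assert ((s w - s u) * (h v - h u) < (s v - s u) * (h v - h u)) by nra. nra. }
      rewrite Rabs_left1 by lra. nra.
  - destruct (Rle_lt_dec 0 (s x - s v)) as [Hr0|Hl0].
    + assert (Hr' : reach k n P S x w (A * (h w - h x) + B * Rabs (s w - s u) - B * (s x - s u))).
      { apply IH; auto; [lia| |].
        - destruct Inx as (b & g & Hb & Hg & Hbg & Hx').
          destruct (linear_comb _ _ _ _ Hx') as [E1 E2]. rewrite E1, E2. nra.
        - intros y Iy Hy; apply (Hnext y Iy Hy). }
      rewrite (Rabs_right (s x - s v)) in Hr by lra.
      apply (reach_le _ _ _ _ _ _ _ _ (reach_trans _ _ _ _ _ _ _ _ _ Hr Hr')). lra.
    (* x lies to the right of the ray uv. If s v > s u, a step up and left from v would end left of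
       that ray; and if s v <= s u, then s w > s u would make the step go right. *)
    + assert (Hsg : s v - s u <= 0 /\ s w - s u <= 0).
      { assert (Hxv : 0 < h x - h v) by (apply Hup; [apply Hx|auto]).
        destruct Inx as (b & g & Hb & Hg & Hbg & Hx').
        destruct (linear_comb _ _ _ _ Hx') as [E1 E2].
        assert (F1 : h x - h v = b * (h v - h u) + g * (h w - h u) - (h v - h u)) by lra.
        assert (F2 : s x - s v = b * (s v - s u) + g * (s w - s u) - (s v - s u)) by lra.
        rewrite F1 in Hxv. rewrite F2 in Hl0.
        set (a1 := h v - h u) in *. set (a2 := h w - h u) in *.
        set (c1 := s v - s u) in *. set (c2 := s w - s u) in *.
        clear - Hhv Hhw Hb Hg Hbg Hxv Hl0 Hside Hwv.
        assert (c1 <= 0).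
        { apply Rnot_lt_le; intro.
          assert (g * c2 < (1 - b) * c1) by lra.
          assert ((1 - b) * a1 < g * a2) by lra.
          assert (g * (c1 * a2) < g * (c2 * a1)) by nra.
          assert ((1 - b) * a1 * c1 < g * a2 * c1) by nra.
          assert (g * c2 * a1 < (1 - b) * c1 * a1) by nra.
          lra. }
        split; [assumption|]. apply Rnot_lt_le; intro. nra. }
      destruct Hsg as [Hv0 Hw0].
      assert (Hr' : reach k n P S x w (A * (h w - h x) - B * (s w - s x))).
      { apply (chain_left N); auto; [lia|].
        intros y Iy Hy. destruct (Hnext y Iy Hy) as [G1 G2]. split; [exact G1|].
        apply G2; lra. }
      rewrite (Rabs_left (s x - s v)) in Hr by lra.
      apply (reach_le _ _ _ _ _ _ _ _ (reach_trans _ _ _ _ _ _ _ _ _ Hr Hr')).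
      rewrite Rabs_left1 by lra. nra.
Qed.

End Chain.

(** * Coordinates along and across a cone bisector *)

(** Completes [bis_proj] to an orthonormal frame; positive on the clockwise side of the bisector. *)
Definition lat_proj (k x : nat) (u v : point) (i : nat) : R :=
  (fst v - fst u) * cos (INR i * theta k x) - (snd v - snd u) * sin (INR i * theta k x).

Lemma sin_cos_sqr (a : R) : sin a * sin a + cos a * cos a = 1.
Proof. exact (sin2_cos2 a). Qed.

Lemma frame_fst (k x : nat) (u v : point) (i : nat) :
  fst v - fst u = bis_proj k x u v i * sin (INR i * theta k x)
                  + lat_proj k x u v i * cos (INR i * theta k x).
Proof.
  unfold bis_proj, lat_proj.
  set (p := INR i * theta k x). pose proof (sin_cos_sqr p) as E.
  transitivity ((fst v - fst u) * (sin p * sin p + cos p * cos p)); [rewrite E; ring|ring].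
Qed.

Lemma frame_snd (k x : nat) (u v : point) (i : nat) :
  snd v - snd u = bis_proj k x u v i * cos (INR i * theta k x)
                  - lat_proj k x u v i * sin (INR i * theta k x).
Proof.
  unfold bis_proj, lat_proj.
  set (p := INR i * theta k x). pose proof (sin_cos_sqr p) as E.
  transitivity ((snd v - snd u) * (sin p * sin p + cos p * cos p)); [rewrite E; ring|ring].
Qed.

Lemma frame_sqr (k x : nat) (u v : point) (i : nat) :
  (fst v - fst u) ^ 2 + (snd v - snd u) ^ 2 = bis_proj k x u v i ^ 2 + lat_proj k x u v i ^ 2.
Proof.
  unfold bis_proj, lat_proj.
  set (p := INR i * theta k x). pose proof (sin_cos_sqr p) as E.
  transitivity (((fst v - fst u) ^ 2 + (snd v - snd u) ^ 2) * (sin p * sin p + cos p * cos p));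
    [rewrite E; ring|ring].
Qed.

Lemma frame_orient (k x : nat) (u v w : point) (i : nat) :
  orient u v w = lat_proj k x u v i * bis_proj k x u w i
                 - lat_proj k x u w i * bis_proj k x u v i.
Proof.
  unfold orient, bis_proj, lat_proj.
  set (p := INR i * theta k x). pose proof (sin_cos_sqr p) as E.
  transitivity (((fst v - fst u) * (snd w - snd u) - (snd v - snd u) * (fst w - fst u))
    * (sin p * sin p + cos p * cos p)); [rewrite E; ring|ring].
Qed.

Lemma polar_frame (k x : nat) (u v : point) (i : nat) (r phi : R) :
  fst v - fst u = r * sin phi -> snd v - snd u = r * cos phi ->
  bis_proj k x u v i = r * cos (phi - INR i * theta k x) /\
  lat_proj k x u v i = r * sin (phi - INR i * theta k x).
Proof.
  intros H1 H2; unfold bis_proj, lat_proj.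
  rewrite H1, H2, cos_minus, sin_minus; split; ring.
Qed.

(** Linear inequalities replace the polar description of the cone, and the explicit angle yields
    uniqueness. *)
Lemma cone_angle_frame (k x : nat) (u v : point) (i : nat) (phi : R) :
  0 < theta k x < PI -> cone_angle k x u v i phi ->
  let t := tan (theta k x / 2) in
  let h := bis_proj k x u v i in
  let s := lat_proj k x u v i in
  0 < h /\ - (t * h) < s < t * h /\ phi = INR i * theta k x + atan (s / h).
Proof.
  intros Hth (_ & Hphi & r & Hr & E1 & E2); cbv zeta.
  destruct (polar_frame k x u v i r phi E1 E2) as [F1 F2].
  set (psi := phi - INR i * theta k x) in *.
  assert (Hpsi : - (theta k x / 2) < psi < theta k x / 2) by (unfold psi; lra).
  assert (Hc : 0 < cos psi) by (apply cos_gt_0; lra).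
  assert (Hh : 0 < bis_proj k x u v i) by (rewrite F1; nra).
  assert (Ht : lat_proj k x u v i = tan psi * bis_proj k x u v i)
    by (rewrite F1, F2; unfold tan; field; lra).
  split; [exact Hh|]. split.
  - assert (T1 : tan psi < tan (theta k x / 2)) by (apply tan_increasing; lra).
    assert (T2 : tan (- (theta k x / 2)) < tan psi) by (apply tan_increasing; lra).
    rewrite tan_neg in T2. rewrite Ht. split; nra.
  - rewrite Ht. replace (tan psi * bis_proj k x u v i / bis_proj k x u v i) with (tan psi)
      by (field; lra).
    rewrite atan_tan by lra. unfold psi; ring.
Qed.

Lemma frame_polar (k x : nat) (u v : point) (i : nat) :
  0 < bis_proj k x u v i ->
  let psi := atan (lat_proj k x u v i / bis_proj k x u v i) in
  exists r, 0 < r /\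
    fst v - fst u = r * sin (INR i * theta k x + psi) /\
    snd v - snd u = r * cos (INR i * theta k x + psi).
Proof.
  intros Hh psi.
  assert (Hc : 0 < cos psi).
  { pose proof (atan_bound (lat_proj k x u v i / bis_proj k x u v i)) as Hb.
    fold psi in Hb. apply cos_gt_0; lra. }
  exists (bis_proj k x u v i / cos psi). split; [apply Rdiv_lt_0_compat; assumption|].
  assert (Hs : lat_proj k x u v i = bis_proj k x u v i / cos psi * sin psi).
  { transitivity (bis_proj k x u v i * tan psi); [|unfold tan; field; lra].
    unfold psi; rewrite tan_atan; field; lra. }
  rewrite sin_plus, cos_plus.
  rewrite (frame_fst k x u v i), (frame_snd k x u v i), Hs.
  split; field; lra.
Qed.

Lemma frame_cone_angle (k x : nat) (u v : point) (i : nat) :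
  0 < theta k x < PI -> (i < ncones k x)%nat ->
  let t := tan (theta k x / 2) in
  let h := bis_proj k x u v i in
  let s := lat_proj k x u v i in
  0 < h -> - (t * h) < s < t * h ->
  cone_angle k x u v i (INR i * theta k x + atan (s / h)).
Proof.
  intros Hth Hi t h s Hh Hs. split; [exact Hi|]. split.
  - assert (Q : - t < s / h < t).
    { split; [apply (Rmult_lt_reg_r h)|apply (Rmult_lt_reg_r h)]; try exact Hh;
        unfold Rdiv; rewrite Rmult_assoc, Rinv_l; lra. }
    assert (T : atan t = theta k x / 2) by (apply atan_tan; lra).
    assert (atan (s / h) < atan t) by (apply atan_increasing; lra).
    assert (atan (- t) < atan (s / h)) by (apply atan_increasing; lra).
    rewrite atan_opp in *. lra.
  - exact (frame_polar k x u v i Hh).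
Qed.

Lemma cone_angle_unique (k x : nat) (u v : point) (i : nat) (p q : R) :
  0 < theta k x < PI -> cone_angle k x u v i p -> cone_angle k x u v i q -> p = q.
Proof.
  intros Hth Hp Hq.
  destruct (cone_angle_frame _ _ _ _ _ _ Hth Hp) as (_ & _ & ->).
  destruct (cone_angle_frame _ _ _ _ _ _ Hth Hq) as (_ & _ & ->). reflexivity.
Qed.

Lemma frame_comb (k x : nat) (u v w c : point) (i : nat) (b g : R) :
  comb u v w b g c ->
  bis_proj k x u c i = b * bis_proj k x u v i + g * bis_proj k x u w i /\
  lat_proj k x u c i = b * lat_proj k x u v i + g * lat_proj k x u w i.
Proof.
  intros [H1 H2]; unfold bis_proj, lat_proj; rewrite H1, H2; split; ring.
Qed.

(** The slope s / h of a positive combination is a weighted mediant of the slopes of v and w, and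
    atan is increasing. This places hull points in the subcone and rules out constraints between v
    and w. *)
Lemma cone_angle_between (k x : nat) (u v w c : point) (i : nat) (pv pw b g : R) :
  0 < theta k x < PI -> orient u v w <> 0 ->
  cone_angle k x u v i pv -> cone_angle k x u w i pw ->
  0 < b -> 0 < g -> comb u v w b g c ->
  exists p, cone_angle k x u c i p /\ (pv < p < pw \/ pw < p < pv).
Proof.
  intros Hth HD Hv Hw Hb Hg Hc.
  pose proof Hv as [Hi _].
  destruct (cone_angle_frame _ _ _ _ _ _ Hth Hv) as (Hhv & Hsv & ->).
  destruct (cone_angle_frame _ _ _ _ _ _ Hth Hw) as (Hhw & Hsw & ->).
  destruct (frame_comb k x u v w c i b g Hc) as [E1 E2].
  rewrite (frame_orient k x u v w i) in HD.
  exists (INR i * theta k x + atan (lat_proj k x u c i / bis_proj k x u c i)).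
  split.
  - apply frame_cone_angle; auto; rewrite E1; [nra|rewrite E2; split; nra].
  - rewrite E1, E2.
    set (hv := bis_proj k x u v i) in *. set (hw := bis_proj k x u w i) in *.
    set (sv := lat_proj k x u v i) in *. set (sw := lat_proj k x u w i) in *.
    assert (Hh : 0 < b * hv + g * hw) by nra.
    assert (Frac : forall a c d e, 0 < c -> 0 < e -> a * e < d * c -> a / c < d / e).
    { intros a c0 d e Hc0 He Hlt. apply (Rmult_lt_reg_r (c0 * e)); [nra|].
      replace (a / c0 * (c0 * e)) with (a * e) by (field; lra).
      replace (d / e * (c0 * e)) with (d * c0) by (field; lra). exact Hlt. }
    destruct (Rlt_le_dec (sv * hw) (sw * hv)) as [L|L].
    + left; split; apply Rplus_lt_compat_l, atan_increasing, Frac; auto; nra.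
    + assert (L' : sw * hv < sv * hw) by lra.
      right; split; apply Rplus_lt_compat_l, atan_increasing, Frac; auto; nra.
Qed.

Lemma frame_dist (k x : nat) (u v : point) (i : nat) :
  edist u v = sqrt (bis_proj k x u v i ^ 2 + lat_proj k x u v i ^ 2).
Proof. unfold edist; f_equal; apply frame_sqr. Qed.

Lemma polar_neq (u v : point) (r phi : R) :
  0 < r -> fst v - fst u = r * sin phi -> snd v - snd u = r * cos phi -> u <> v.
Proof.
  intros Hr H1 H2 ->. pose proof (sin_cos_sqr phi).
  assert (sin phi = 0) by nra. assert (cos phi = 0) by nra. nra.
Qed.

(** * Trigonometric constants *)

(** f(x) = A sin x + B cos x takes equal values at q and PI / 2, so it peaks at their midpoint M.
    The difference f(phi) - f(g) is 2 sin((phi - g) / 2) f'(m) with m = (phi + g) / 2 <= M, and both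
    factors are nonnegative. *)
Lemma sinusoid_le (A B q g phi : R) :
  0 < A -> 0 < B -> 0 <= g <= q -> q <= phi <= PI / 2 -> q < PI / 2 ->
  A * sin q + B * cos q = A ->
  A * sin g + B * cos g <= A * sin phi + B * cos phi.
Proof.
  intros HA HB Hg Hphi Hq E. pose proof PI_RGT_0 as Hpi.
  set (M := (PI / 2 + q) / 2). set (m := (phi + g) / 2).
  assert (EM : A * cos M = B * sin M).
  { assert (F1 := form4 (PI / 2) q). assert (F2 := form2 (PI / 2) q).
    rewrite sin_PI2 in F1. rewrite cos_PI2 in F2. fold M in F1, F2.
    assert (Hs : 0 < sin ((PI / 2 - q) / 2)) by (apply sin_gt_0; lra).
    apply (Rmult_eq_reg_l (sin ((PI / 2 - q) / 2))); [|lra]. nra. }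
  assert (Hm : A * cos m >= B * sin m).
  { assert (cos M <= cos m) by (apply cos_decr_1; unfold M, m; lra).
    assert (sin m <= sin M) by (apply sin_incr_1; unfold M, m; lra).
    nra. }
  assert (F1 := form4 phi g). assert (F2 := form2 phi g). fold m in F1, F2.
  assert (Hs : 0 <= sin ((phi - g) / 2)) by (apply sin_ge_0; lra).
  assert (0 <= sin ((phi - g) / 2) * (A * cos m - B * sin m)) by (apply Rmult_le_pos; lra).
  nra.
Qed.

Lemma theta_pos (k : nat) : 0 < theta k 3.
Proof.
  unfold theta, ncones. pose proof PI_RGT_0.
  apply Rdiv_lt_0_compat; [lra|]. apply lt_0_INR; lia.
Qed.

Lemma theta_mul (k : nat) : INR (ncones k 3) * theta k 3 = 2 * PI.
Proof.
  unfold theta. field. apply not_0_INR. unfold ncones; lia.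
Qed.

Lemma theta_small (k : nat) : (1 <= k)%nat -> theta k 3 <= 2 * PI / 7.
Proof.
  intros Hk. pose proof (theta_mul k) as E. pose proof (theta_pos k).
  assert (7 <= INR (ncones k 3)).
  { replace 7 with (INR 7) by (cbn; ring). apply le_INR. unfold ncones; lia. }
  nra.
Qed.

Definition spread (th : R) : R := cos (th / 4) / (cos (th / 2) - sin (3 * th / 4)).

(** With this coefficient the two linear bounds are [rise] times h, plus or minus [spread] times
    s. *)
Definition rise (th : R) : R := / cos (th / 2) + spread th * tan (th / 2).

Section Constants.

Variable th : R.
Hypothesis Hth : 0 < th <= 2 * PI / 7.

Lemma cos_half_pos : 0 < cos (th / 2).
Proof. pose proof PI_RGT_0. apply cos_gt_0; lra. Qed.

(** th < 2 PI / 5 gives th / 2 < PI / 2 - 3 th / 4, and cos decreases. *)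
Lemma spread_den_pos : 0 < cos (th / 2) - sin (3 * th / 4).
Proof.
  pose proof PI_RGT_0.
  rewrite <- (cos_shift (3 * th / 4)).
  assert (cos (PI / 2 - 3 * th / 4) < cos (th / 2)) by (apply cos_decreasing_1; lra). lra.
Qed.

Lemma spread_ge_1 : 1 <= spread th.
Proof.
  pose proof PI_RGT_0. pose proof spread_den_pos as Hd.
  assert (cos (th / 2) < cos (th / 4)) by (apply cos_decreasing_1; lra).
  assert (0 < sin (3 * th / 4)) by (apply sin_gt_0; lra).
  unfold spread. apply (Rmult_le_reg_r (cos (th / 2) - sin (3 * th / 4))); [exact Hd|].
  set (d := cos (th / 2) - sin (3 * th / 4)) in *.
  replace (cos (th / 4) / d * d) with (cos (th / 4)) by (field; lra). unfold d; lra.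
Qed.

Lemma tan_half_nonneg : 0 <= tan (th / 2).
Proof. pose proof PI_RGT_0. left; apply tan_gt_0; lra. Qed.

(** At least seven cones give th / 2 <= PI / 7 < PI / 6. This is the width condition that makes hull
    edges shorter than uw. *)
Lemma tan_half_small : 3 * (tan (th / 2) * tan (th / 2)) < 1.
Proof.
  pose proof PI_RGT_0. pose proof cos_half_pos as Hc.
  assert (Hs : sin (th / 2) < sin (PI / 6)) by (apply sin_increasing_1; lra).
  assert (Hs0 : 0 < sin (th / 2)) by (apply sin_gt_0; lra).
  rewrite sin_PI6 in Hs. pose proof (sin_cos_sqr (th / 2)) as E.
  unfold tan. apply (Rmult_lt_reg_r (cos (th / 2) * cos (th / 2))); [nra|].
  replace (3 * (sin (th / 2) / cos (th / 2) * (sin (th / 2) / cos (th / 2)))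
    * (cos (th / 2) * cos (th / 2))) with (3 * (sin (th / 2) * sin (th / 2))) by (field; lra).
  nra.
Qed.

Lemma rise_pos : 0 < rise th.
Proof.
  unfold rise. pose proof (Rinv_0_lt_compat _ cos_half_pos).
  pose proof spread_ge_1. pose proof tan_half_nonneg. nra.
Qed.

(* This equation is what determines the constant spread th. *)
Lemma spread_balanced :
  spread th * sin (th / 4) + rise th * cos (th / 4) = spread th.
Proof.
  pose proof cos_half_pos as Hc. pose proof spread_den_pos as Hd.
  assert (E : sin (3 * th / 4) = sin (th / 2) * cos (th / 4) + cos (th / 2) * sin (th / 4)).
  { replace (3 * th / 4) with (th / 2 + th / 4) by field. apply sin_plus. }
  unfold rise, spread, tan. rewrite E in *. field. split; lra.
Qed.

(** Triangle inequality through the corner at height h with lateral coordinate - tan(th / 2) h: it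
    is h / cos(th / 2) from the origin and s + tan(th / 2) h from the point. The second part may be
    weighted by [spread], which is at least 1. *)
Lemma dist_le_spread (h s : R) :
  0 < h -> - (tan (th / 2) * h) <= s ->
  sqrt (h ^ 2 + s ^ 2) <= rise th * h + spread th * s.
Proof.
  intros Hh Hs. pose proof cos_half_pos as Hc. pose proof spread_ge_1 as Hsp.
  pose proof tan_half_nonneg as Ht. pose proof (Rinv_0_lt_compat _ Hc) as Hi.
  assert (E : / cos (th / 2) * / cos (th / 2) = 1 + tan (th / 2) * tan (th / 2)).
  { pose proof (sin_cos_sqr (th / 2)) as E. unfold tan.
    apply (Rmult_eq_reg_r (cos (th / 2) * cos (th / 2))); [|nra].
    field_simplify; [|lra|lra]. nra. }
  unfold rise. set (ic := / cos (th / 2)) in *. set (t := tan (th / 2)) in *.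
  set (c := spread th) in *.
  apply Rle_trans with (ic * h + (s + t * h)).
  - rewrite <- (sqrt_pow2 (ic * h + (s + t * h))) by nra.
    apply sqrt_le_1_alt.
    assert (0 <= 2 * (t * h) * (s + t * h)) by (apply Rmult_le_pos; nra).
    assert (0 <= 2 * (ic * h) * (s + t * h)) by (apply Rmult_le_pos; nra).
    assert (E2 : (ic * h) * (ic * h) = (1 + t * t) * (h * h)) by (rewrite <- E; ring).
    nra.
  - assert (s + t * h <= c * (s + t * h)) by nra. lra.
Qed.

End Constants.

(** * Edge directions when the number of cones is odd *)

Lemma sin_cos_period_Z (a : R) (z : Z) :
  sin (a + IZR z * (2 * PI)) = sin a /\ cos (a + IZR z * (2 * PI)) = cos a.
Proof.
  assert (Pos : forall (b : R) (m : nat), sin (b + INR m * (2 * PI)) = sin b /\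
    cos (b + INR m * (2 * PI)) = cos b).
  { intros b m. replace (b + INR m * (2 * PI)) with (b + 2 * INR m * PI) by ring.
    split; [apply sin_period|apply cos_period]. }
  destruct (Z_le_gt_dec 0 z) as [Hz|Hz].
  - rewrite <- (Z2Nat.id z Hz), <- INR_IZR_INZ. apply Pos.
  - destruct (Pos (a + IZR z * (2 * PI)) (Z.to_nat (- z))) as [H1 H2].
    replace (a + IZR z * (2 * PI) + INR (Z.to_nat (- z)) * (2 * PI)) with a in H1, H2.
    + split; auto.
    + rewrite INR_IZR_INZ, Z2Nat.id by lia. rewrite opp_IZR. ring.
Qed.

(* Since the number of cones is odd, the bisectors of the cones and their
   opposites together point in all multiples of theta / 2. *)
Lemma nearest_bisector (k : nat) (phi : R) :
  exists (j : nat) (gam e : R), (j < ncones k 3)%nat /\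
    - (theta k 3 / 4) <= gam <= theta k 3 / 4 /\ (e = 1 \/ e = -1) /\
    sin phi = e * sin (INR j * theta k 3 + gam) /\
    cos phi = e * cos (INR j * theta k 3 + gam).
Proof.
  pose proof (theta_pos k) as Hth. pose proof (theta_mul k) as Hn.
  set (th := theta k 3) in *. set (n := ncones k 3) in *.
  (* [up (y - / 2)] rounds y = 2 phi / th to a nearest integer, whence |gam| <= th / 4. *)
  set (m := (up (2 * phi / th - / 2))%Z).
  set (gam := phi - IZR m * (th / 2)).
  assert (Hg : - (th / 4) <= gam <= th / 4).
  { destruct (archimed (2 * phi / th - / 2)) as [U1 U2]. fold m in U1, U2.
    assert (E : phi = (2 * phi / th) * (th / 2)) by (field; lra).
    unfold gam. split; rewrite E; nra. }
  set (N := (2 * Z.of_nat n)%Z).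
  assert (HN : (0 < N)%Z) by (unfold N, n, ncones; lia).
  set (z := (m / N)%Z). set (r := (m mod N)%Z).
  assert (Hm : m = (N * z + r)%Z) by (apply Z.div_mod; lia).
  assert (Hr : (0 <= r < N)%Z) by (apply Z.mod_pos_bound; lia).
  assert (HNR : IZR N * (th / 2) = 2 * PI).
  { unfold N. rewrite mult_IZR, <- INR_IZR_INZ. lra. }
  assert (Hphi : phi = (IZR r * (th / 2) + gam) + IZR z * (2 * PI)).
  { unfold gam. rewrite Hm, plus_IZR, mult_IZR. rewrite <- HNR. ring. }
  destruct (sin_cos_period_Z (IZR r * (th / 2) + gam) z) as [P1 P2].
  rewrite <- Hphi in P1, P2.
  (* For odd r, shifting by the odd number n gives an even multiple of th / 2 and amounts to a half
     turn, hence e = -1. The offsets 2k + 2 and 2k + 1 are (n + 1) / 2 and (n - 1) / 2. *)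
  assert (Hq : exists j : Z, (0 <= j < Z.of_nat n)%Z /\
    (r = 2 * j \/ r = 2 * j - Z.of_nat n \/ r = 2 * j + Z.of_nat n)%Z).
  { unfold N in Hr.
    destruct (Z.Even_or_Odd r) as [[j Hj]|[j Hj]].
    - exists j; lia.
    - destruct (Z_lt_ge_dec r (Z.of_nat n)).
      + exists (j + Z.of_nat (2 * k + 2))%Z. unfold n, ncones in *. lia.
      + exists (j - Z.of_nat (2 * k + 1))%Z. unfold n, ncones in *. lia. }
  destruct Hq as (j & Hj & Hrj).
  assert (Ej : INR (Z.to_nat j) = IZR j) by (rewrite INR_IZR_INZ, Z2Nat.id; [reflexivity|lia]).
  assert (Hpi : IZR (Z.of_nat n) * (th / 2) = PI) by (rewrite <- INR_IZR_INZ; lra).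
  exists (Z.to_nat j), gam. rewrite Ej, P1, P2.
  destruct Hrj as [Hrj|[Hrj|Hrj]]; rewrite Hrj.
  - exists 1. split; [lia|]. split; [exact Hg|]. split; [left; reflexivity|].
    rewrite mult_IZR. replace (2 * IZR j * (th / 2) + gam) with (IZR j * th + gam) by field.
    split; ring.
  - exists (-1). split; [lia|]. split; [exact Hg|]. split; [right; reflexivity|].
    replace (IZR j * th + gam) with (IZR (2 * j - Z.of_nat n) * (th / 2) + gam + PI).
    + rewrite neg_sin, neg_cos. split; ring.
    + rewrite minus_IZR, mult_IZR, <- Hpi. field.
  - exists (-1). split; [lia|]. split; [exact Hg|]. split; [right; reflexivity|].
    replace (IZR (2 * j + Z.of_nat n) * (th / 2) + gam) with (IZR j * th + gam + PI).
    + rewrite neg_sin, neg_cos. split; ring.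
    + rewrite plus_IZR, mult_IZR, <- Hpi. field.
Qed.

(* With a, b the corners of the canonical triangle opposite u and c := spread, this is
   the larger of |ua| + c |av| and |ub| + c |bv|. *)
Definition cone_bound (k : nat) (u v : point) (i : nat) : R :=
  rise (theta k 3) * bis_proj k 3 u v i + spread (theta k 3) * Rabs (lat_proj k 3 u v i).

Lemma cone_bound_polar (k : nat) (u v : point) (i : nat) (r psi : R) :
  0 < r -> - (PI / 2) <= psi <= PI / 2 ->
  fst v - fst u = r * sin (INR i * theta k 3 + psi) ->
  snd v - snd u = r * cos (INR i * theta k 3 + psi) ->
  cone_bound k u v i =
    r * (spread (theta k 3) * sin (Rabs psi) + rise (theta k 3) * cos (Rabs psi)).
Proof.
  intros Hr Hpsi E1 E2. pose proof PI_RGT_0.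
  destruct (polar_frame k 3 u v i r _ E1 E2) as [F1 F2].
  replace (INR i * theta k 3 + psi - INR i * theta k 3) with psi in F1, F2 by ring.
  unfold cone_bound; rewrite F1, F2, Rabs_mult, (Rabs_right r) by lra.
  destruct (Rle_lt_dec 0 psi) as [Hp|Hp].
  - rewrite (Rabs_right psi) by lra.
    rewrite Rabs_right by (apply Rle_ge, sin_ge_0; lra). ring.
  - rewrite (Rabs_left psi) by lra. rewrite sin_neg, cos_neg.
    rewrite Rabs_left1; [ring|].
    rewrite <- (Ropp_involutive psi), sin_neg.
    assert (0 <= sin (- psi)) by (apply sin_ge_0; lra). lra.
Qed.

(** The bound is measured in the frame of C_i although q may lie outside that cone of p. Unless pq
    is within theta / 4 of this bisector, the induction hypothesis is used in the cone of the
    nearest bisector, at p or at q, and [sinusoid_le] shows that its bound is no larger. *)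
Lemma edge_from_cones (k : nat) (P : list point) (S : list (point * point)) (D : R)
  (p q : point) (i : nat) :
  (1 <= k)%nat -> (i < ncones k 3)%nat ->
  (forall a b j, In a P -> In b P -> clear S a b -> edist a b < D ->
     in_cone k 3 a b j -> reach k 3 P S a b (cone_bound k a b j)) ->
  In p P -> In q P -> clear S p q -> 0 < bis_proj k 3 p q i -> edist p q < D ->
  reach k 3 P S p q (cone_bound k p q i).
Proof.
  intros Hk Hi IH Ip Iq Hc Hh HD. pose proof PI_RGT_0 as Hpi.
  assert (Hth : 0 < theta k 3 <= 2 * PI / 7) by (split; [apply theta_pos|apply theta_small, Hk]).
  destruct (frame_polar k 3 p q i Hh) as (r & Hr & E1 & E2).
  set (psi := atan (lat_proj k 3 p q i / bis_proj k 3 p q i)) in *.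
  assert (Hpsi : - (PI / 2) < psi < PI / 2).
  { pose proof (atan_bound (lat_proj k 3 p q i / bis_proj k 3 p q i)) as Hb; fold psi in Hb; lra. }
  destruct (Rlt_le_dec (Rabs psi) (theta k 3 / 4)) as [Hs|Hs].
  { apply IH; auto. exists (INR i * theta k 3 + psi).
    apply Rabs_def2 in Hs.
    split; [exact Hi|]. split; [lra|]. exists r; auto. }
  rewrite (cone_bound_polar k p q i r psi) by (auto; lra).
  destruct (nearest_bisector k (INR i * theta k 3 + psi))
    as (j & gam & e & Hj & Hgam & He & S1 & S2).
  set (al := INR j * theta k 3 + gam) in *.
  assert (Hle : r * (spread (theta k 3) * sin (Rabs gam) + rise (theta k 3) * cos (Rabs gam))
    <= r * (spread (theta k 3) * sin (Rabs psi) + rise (theta k 3) * cos (Rabs psi))).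
  { apply Rmult_le_compat_l; [lra|].
    apply (sinusoid_le _ _ (theta k 3 / 4)).
    - pose proof (spread_ge_1 _ Hth); lra.
    - exact (rise_pos _ Hth).
    - split; [apply Rabs_pos|apply Rabs_le; lra].
    - split; [exact Hs|apply Rabs_le; lra].
    - lra.
    - exact (spread_balanced _ Hth). }
  assert (Hcone : forall a b, fst b - fst a = r * sin al -> snd b - snd a = r * cos al ->
    in_cone k 3 a b j /\ cone_bound k a b j <=
    r * (spread (theta k 3) * sin (Rabs psi) + rise (theta k 3) * cos (Rabs psi))).
  { intros a b A1 A2. split.
    - exists al. split; [exact Hj|]. split; [unfold al; lra|]. exists r; auto.
    - rewrite (cone_bound_polar k a b j r gam); auto. lra. }
  rewrite S1 in E1; rewrite S2 in E2.
  destruct He as [-> | ->].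
  - destruct (Hcone p q) as [C1 C2]; [lra|lra|].
    apply (reach_le _ _ _ _ _ _ _ _ (IH p q j Ip Iq Hc HD C1) C2).
  - destruct (Hcone q p) as [C1 C2]; [lra|lra|].
    apply reach_sym. rewrite edist_sym in HD.
    apply (reach_le _ _ _ _ _ _ _ _ (IH q p j Iq Ip (clear_sym _ _ _ Hc) HD C1) C2).
Qed.

(** * Subcones *)

(** [Q] is a partial function given as a relation, as a constraint has an angle only if it lies in
    the cone. [a0] stands for the cone boundary, used when no constraint qualifies. *)
Lemma greatest_value (A : Type) (Q : A -> R -> Prop) (ok : R -> Prop) (a0 : R) (l : list A) :
  ok a0 -> (forall t x y, Q t x -> Q t y -> x = y) ->
  exists a, ok a /\ (a = a0 \/ exists t, In t l /\ Q t a) /\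
    forall t x, In t l -> Q t x -> ok x -> x <= a.
Proof.
  intros H0 HQ. induction l as [|t l (a & Ha & Hd & Hmax)].
  - exists a0; repeat split; auto. intros t x [].
  - destruct (classic (exists x, Q t x /\ ok x /\ a < x)) as [(x & Hx & Okx & Lx)|Hn].
    + exists x. split; [exact Okx|]. split; [right; exists t; cbn; auto|].
      intros t' x' [<-|Ht'] Hx' Ok'.
      * rewrite (HQ _ _ _ Hx Hx'); lra.
      * specialize (Hmax t' x' Ht' Hx' Ok'); lra.
    + exists a. split; [exact Ha|]. split.
      * destruct Hd as [Hd|(t' & Ht' & Hq)]; [left; exact Hd|right; exists t'; cbn; auto].
      * intros t' x' [<-|Ht'] Hx' Ok'; [|exact (Hmax t' x' Ht' Hx' Ok')].
        apply Rnot_lt_le; intro; apply Hn; exists x'; auto.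
Qed.

Lemma subcone_exists (k x : nat) (P : list point) (S : list (point * point))
  (u w : point) (i : nat) (phi : R) :
  0 < theta k x < PI -> valid_constraints P S -> cone_angle k x u w i phi ->
  exists a b, subcone k x S u i a b /\ a <= phi <= b.
Proof.
  intros Hth HS Hw. pose proof Hw as (Hi & Hphi & _).
  set (Q := fun (c : point) (a : R) => is_constraint S u c /\ cone_angle k x u c i a).
  assert (HQ : forall c a b, Q c a -> Q c b -> a = b).
  { intros c a b [_ Ha] [_ Hb]. exact (cone_angle_unique _ _ _ _ _ _ _ Hth Ha Hb). }
  destruct (greatest_value _ Q (fun a => a <= phi) (INR i * theta k x - theta k x / 2) P)
    as (a & La & Ca & Ma); auto; [lra|].
  (* The upper ray is a maximum of negated angles. It is strictly beyond phi while the lower one may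
     equal phi, so a < - b even when uw is itself a constraint. *)
  destruct (greatest_value _ (fun c a => Q c (- a)) (fun a => a < - phi)
    (- (INR i * theta k x + theta k x / 2)) P) as (b & Lb & Cb & Mb); [lra| |].
  { intros c y z Hy Hz. assert (- y = - z) by exact (HQ _ _ _ Hy Hz). lra. }
  exists a, (- b). split; [|lra].
  split; [exact Hi|]. split; [lra|]. split; [|split].
  - destruct Ca as [->|(c & _ & Hc)]; [left; reflexivity|right; right; exists c; exact Hc].
  - destruct Cb as [->|(c & _ & Hc)]; [right; left; ring|right; right; exists c; exact Hc].
  - intros (c & p & Hc & Hp & Hab).
    destruct (constraint_in _ _ _ _ HS Hc) as (_ & Ic & _).
    destruct (Rle_lt_dec p phi).
    + assert (p <= a) by (apply (Ma c); auto; split; assumption). lra.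
    + assert (- p <= b).
      { apply (Mb c); [exact Ic| |lra]. rewrite Ropp_involutive; split; assumption. }
      lra.
Qed.

(** * Induction over visible pairs *)

Lemma cone_bound_reach (k : nat) (P : list point) (S : list (point * point)) :
  (1 <= k)%nat -> general_position k 3 P -> valid_constraints P S ->
  forall u w i, In u P -> In w P -> clear S u w -> in_cone k 3 u w i ->
  reach k 3 P S u w (cone_bound k u w i).
Proof.
  intros Hk (GP & _ & GPbis) HS. pose proof PI_RGT_0 as Hpi.
  assert (Hth : 0 < theta k 3 <= 2 * PI / 7) by (split; [apply theta_pos|apply theta_small, Hk]).
  assert (Hth' : 0 < theta k 3 < PI) by lra.
  pose (closer := fun d (pq : point * point) => edist (fst pq) (snd pq) < d).
  (* Induction on the distance |uw|, made well-founded by counting the pairs of P that are closer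
     together. *)
  cut (forall N u w i, (count _ (closer (edist u w)) (list_prod P P) < N)%nat ->
    In u P -> In w P -> clear S u w -> in_cone k 3 u w i ->
    reach k 3 P S u w (cone_bound k u w i)).
  { intros H u w i Iu Iw Hc Hi. apply (H (Datatypes.S _) u w i (Nat.lt_succ_diag_r _)); auto. }
  induction N as [|N IH]; intros u w i HN Iu Iw Cw [pw Hw]; [lia|].
  assert (IH' : forall a b j, In a P -> In b P -> clear S a b -> edist a b < edist u w ->
     in_cone k 3 a b j -> reach k 3 P S a b (cone_bound k a b j)).
  { intros a b j Ia Ib Hc Hd Hj. apply IH; auto.
    apply Nat.lt_le_trans with (count _ (closer (edist u w)) (list_prod P P)); [|lia].
    apply (count_lt _ _ _ _ (a, b)); unfold closer; cbn.
    - intros; lra.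
    - apply in_prod; assumption.
    - exact Hd.
    - lra. }
  clear IH HN.
  pose proof Hw as [Hi _].
  destruct (cone_angle_frame _ _ _ _ _ _ Hth' Hw) as (Hhw & Hsw & _).
  destruct (subcone_exists k 3 P S u w i pw Hth' HS Hw) as (a & b & Hab & Hpw).
  destruct (list_argmin _ (fun v => bis_proj k 3 u v i)
    (fun v => in_subcone k 3 u i a b v /\ sees S u v) P) as (v & Iv & [Hvs Hv] & Hmin).
  { exists w. split; [exact Iw|]. split; [exists pw; auto|].
    apply (sees_clear P); auto. }
  assert (Huv : theta_edge k 3 P S u v).
  { left. split; [exact Iu|]. split; [exact Iv|].
    exists i, a, b. split; [exact Hab|]. split; [exact Hvs|]. split; [exact Hv|].
    intros y Iy Hy1 Hy2. apply Hmin; auto. }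
  assert (Cv : clear S u v) by (apply (sees_clear P); auto).
  destruct Hvs as (pv & Hva & Hpv).
  destruct (cone_angle_frame _ _ _ _ _ _ Hth' Hva) as (Hhv & Hsv & _).
  destruct (classic (v = w)) as [->|Nvw].
  { apply (reach_le _ _ _ _ _ _ _ _ (reach_edge _ _ _ _ _ _ Huv)).
    rewrite (frame_dist k 3 u w i). unfold cone_bound.
    apply Rle_trans with (sqrt (bis_proj k 3 u w i ^ 2 + Rabs (lat_proj k 3 u w i) ^ 2)).
    - rewrite pow2_abs. lra.
    - apply dist_le_spread; auto. pose proof (tan_half_nonneg _ Hth).
      pose proof (Rabs_pos (lat_proj k 3 u w i)). nra. }
  assert (Nu : forall y p, cone_angle k 3 u y i p -> u <> y).
  { intros y p (_ & _ & r & Hr & E1 & E2). exact (polar_neq _ _ _ _ Hr E1 E2). }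
  assert (HD : orient u v w <> 0) by (apply GP; auto; eauto).
  assert (Hnf : no_fan S u v w).
  { intros c l m Hc Hl Hm Hcb.
    destruct (cone_angle_between k 3 u v w c i pv pw l m) as (p & Hp & Hbet); auto.
    destruct Hab as (_ & _ & _ & _ & Hno). apply Hno.
    exists c, p. split; [exact Hc|]. split; [exact Hp|lra]. }
  (* Such a y is visible and in the subcone, so the choice of v puts it no lower than v; general
     position makes this strict. *)
  assert (Hup : forall y, In y P -> y = w \/ (inside u v w y /\ clear S u y) ->
    0 < bis_proj k 3 v y i).
  { intros y Iy Hy.
    assert (Nvy : v <> y).
    { intros <-. destruct Hy as [Hy|[Hy _]]; [auto|].
      exact (not_inside_vertex _ _ _ HD Hy). }
    assert (Hle : bis_proj k 3 u v i <= bis_proj k 3 u y i).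
    { destruct Hy as [->|[(l & m & Hl & Hm & Hlm & Hy) Hcy]]; apply Hmin; auto.
      - split; [exists pw; auto|apply (sees_clear P); auto].
      - split; [|apply (sees_clear P); auto].
        destruct (cone_angle_between k 3 u v w y i pv pw l m) as (p & Hp & Hbet); auto.
        exists p; split; [exact Hp|lra]. }
    assert (bis_proj k 3 v y i <> 0) by (apply GPbis; auto).
    replace (bis_proj k 3 v y i) with (bis_proj k 3 u y i - bis_proj k 3 u v i) in *
      by (unfold bis_proj; ring).
    lra. }
  set (ci := cos (INR i * theta k 3)). set (si := sin (INR i * theta k 3)).
  (* The sign o reflects the frame so that v lies to the left of uw. *)
  assert (Hside : exists o, (o = 1 \/ o = -1) /\
    o * lat_proj k 3 u v i * bis_proj k 3 u w i < o * lat_proj k 3 u w i * bis_proj k 3 u v i).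
  { rewrite (frame_orient k 3 u v w i) in HD.
    destruct (Rlt_le_dec (lat_proj k 3 u v i * bis_proj k 3 u w i)
      (lat_proj k 3 u w i * bis_proj k 3 u v i)).
    - exists 1; split; [auto|lra].
    - exists (-1); split; [auto|lra]. }
  destruct Hside as (o & Ho & Hside).
  assert (Ho2 : o * o = 1) by (destruct Ho as [-> | ->]; ring).
  assert (Habs : forall y, Rabs (o * y) = Rabs y).
  { intros y. destruct Ho as [-> | ->]; [f_equal; ring|].
    rewrite <- Rabs_Ropp. f_equal; ring. }
  assert (Eh : forall p q, (si * fst q + ci * snd q) - (si * fst p + ci * snd p)
    = bis_proj k 3 p q i) by (intros; unfold bis_proj, si, ci; ring).
  assert (Es : forall p q, (o * ci * fst q + - (o * si) * snd q)
    - (o * ci * fst p + - (o * si) * snd p) = o * lat_proj k 3 p q i)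
    by (intros; unfold lat_proj, si, ci; ring).
  assert (Wedge : forall y, - (tan (theta k 3 / 2) * bis_proj k 3 u y i) < lat_proj k 3 u y i
      < tan (theta k 3 / 2) * bis_proj k 3 u y i ->
    - (tan (theta k 3 / 2) * bis_proj k 3 u y i) <= o * lat_proj k 3 u y i
      <= tan (theta k 3 / 2) * bis_proj k 3 u y i)
    by (intros y Hy; destruct Ho as [-> | ->]; lra).
  assert (Hr : reach k 3 P S v w (rise (theta k 3) * bis_proj k 3 v w i +
    spread (theta k 3) * Rabs (o * lat_proj k 3 u w i)
    - spread (theta k 3) * (o * lat_proj k 3 u v i))).
  { rewrite <- !Eh, <- !Es.
    apply (chain_bound k 3 P S u w si ci (o * ci) (- (o * si))
      (rise (theta k 3)) (spread (theta k 3)) (tan (theta k 3 / 2)))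
      with (N := Datatypes.S (count _ (inside u v w) P)); auto.
    - intros p q. rewrite Eh, Es, (frame_dist k 3 p q i). f_equal.
      replace ((o * lat_proj k 3 p q i) ^ 2) with (o * o * lat_proj k 3 p q i ^ 2) by ring.
      rewrite Ho2. ring.
    - exact (tan_half_nonneg _ Hth).
    - exact (tan_half_small _ Hth).
    - pose proof (spread_ge_1 _ Hth); lra.
    - rewrite Eh; exact Hhw.
    - rewrite Eh, Es; auto.
    - intros p q Ip Iq Hc. rewrite Eh, Es, Habs. intros Hh Hd.
      exact (edge_from_cones k P S _ p q i Hk Hi IH' Ip Iq Hc Hh Hd).
    - split; [exact Iv|]. split; [exact HD|]. split; [exact Cv|]. split; [exact Hnf|].
      rewrite Eh, Es; split; auto.
    - rewrite !Eh, !Es; exact Hside.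
    - intros y Iy Hy. rewrite Eh. auto. }
  apply (reach_le _ _ _ _ _ _ _ _ (reach_trans _ _ _ _ _ _ _ _ _
    (reach_edge _ _ _ _ _ _ Huv) Hr)).
  (* The lateral term of v here cancels the one subtracted in the chain bound, and the heights add
     up to that of w. *)
  assert (Hd : edist u v <= rise (theta k 3) * bis_proj k 3 u v i
    + spread (theta k 3) * (o * lat_proj k 3 u v i)).
  { rewrite (frame_dist k 3 u v i).
    replace (lat_proj k 3 u v i ^ 2) with ((o * lat_proj k 3 u v i) ^ 2).
    - apply dist_le_spread; auto. apply Wedge; exact Hsv.
    - transitivity (o * o * lat_proj k 3 u v i ^ 2); [ring|rewrite Ho2; ring]. }
  unfold cone_bound. rewrite Habs.
  replace (bis_proj k 3 u w i) with (bis_proj k 3 u v i + bis_proj k 3 v w i)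
    by (unfold bis_proj; ring).
  lra.
Qed.

(** * The bound in terms of alpha *)

(** The midpoint is the foot of the perpendicular from w to the bisector, so h and |s| are the legs
    of a right triangle with hypotenuse uw. *)
Lemma canon_mid_angle (k x : nat) (u w : point) (i : nat) :
  0 < bis_proj k x u w i ->
  cos (uangle u w (canon_mid k x u w i)) * edist u w = bis_proj k x u w i /\
  sin (uangle u w (canon_mid k x u w i)) * edist u w = Rabs (lat_proj k x u w i).
Proof.
  intros Hh.
  set (h := bis_proj k x u w i) in *. set (s := lat_proj k x u w i).
  assert (Ed : edist u w = sqrt (h ^ 2 + s ^ 2)) by apply frame_dist.
  assert (Hpos : 0 < h ^ 2 + s ^ 2) by nra.
  assert (Hd : 0 < edist u w) by (rewrite Ed; apply sqrt_lt_R0; exact Hpos).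
  assert (Hd2 : edist u w * edist u w = h ^ 2 + s ^ 2) by (rewrite Ed; apply sqrt_sqrt; lra).
  assert (Em : edist u (canon_mid k x u w i) = h).
  { unfold edist, canon_mid; cbn [fst snd]. fold h.
    replace ((fst u + h * sin (INR i * theta k x) - fst u) ^ 2 +
      (snd u + h * cos (INR i * theta k x) - snd u) ^ 2) with (h ^ 2).
    - apply sqrt_pow2; lra.
    - transitivity (h ^ 2 * (sin (INR i * theta k x) * sin (INR i * theta k x)
        + cos (INR i * theta k x) * cos (INR i * theta k x))); [rewrite sin_cos_sqr; ring|ring]. }
  assert (Ea : uangle u w (canon_mid k x u w i) = acos (h / edist u w)).
  { unfold uangle. f_equal. rewrite Em.
    replace ((fst w - fst u) * (fst (canon_mid k x u w i) - fst u)
      + (snd w - snd u) * (snd (canon_mid k x u w i) - snd u)) with (h * h).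
    - field; lra.
    - unfold canon_mid; cbn [fst snd]. fold h. unfold h at 1, bis_proj. ring. }
  assert (Hhd : h <= edist u w) by nra.
  assert (Hq : -1 <= h / edist u w <= 1).
  { assert (0 < h / edist u w) by (apply Rdiv_lt_0_compat; assumption).
    split; [lra|]. apply (Rmult_le_reg_r (edist u w)); [exact Hd|].
    replace (h / edist u w * edist u w) with h by (field; lra). lra. }
  rewrite Ea, cos_acos, sin_acos by exact Hq. split; [field; lra|].
  rewrite <- (sqrt_pow2 (edist u w)) at 2 by lra.
  rewrite <- sqrt_mult_alt, <- sqrt_Rsqr_abs.
  - f_equal. unfold Rsqr.
    replace ((1 - h / edist u w * (h / edist u w)) * edist u w ^ 2)
      with (edist u w * edist u w - h ^ 2) by (field; lra).
    rewrite Hd2; ring.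
  - unfold Rsqr. assert (0 < h / edist u w) by (apply Rdiv_lt_0_compat; assumption). nra.
Qed.

Theorem theorem4 (k : nat) (P : list point) (S : list (point * point))
  (u w : point) (i : nat) :
  (1 <= k)%nat ->
  NoDup P ->
  general_position k 3 P ->
  valid_constraints P S ->
  In u P -> In w P -> u <> w ->
  sees S u w ->
  in_cone k 3 u w i ->
  let th := theta k 3 in
  let m := canon_mid k 3 u w i in
  let alpha := uangle u w m in
  exists l : list point,
    is_path k 3 P S u l w /\
    path_len u l <=
      (cos alpha / cos (th / 2)
       + (cos alpha * tan (th / 2) + sin alpha) * cos (th / 4)
         / (cos (th / 2) - sin (3 * th / 4))) * edist u w.
Proof.
  intros Hk _ HG HS Iu Iw _ Huw Hi th m alpha.
  apply (sees_clear P) in Huw; [|exact HS].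
  pose proof PI_RGT_0.
  assert (Hth : 0 < th <= 2 * PI / 7) by (split; [apply theta_pos|apply theta_small, Hk]).
  destruct (cone_bound_reach k P S Hk HG HS u w i Iu Iw Huw Hi) as (l & Hl & Hlen).
  exists l; split; [exact Hl|].
  (* The claimed value equals [cone_bound] once h and |s| are written through alpha, so equality
     remains to be shown. *)
  apply (Rle_trans _ _ _ Hlen). right.
  destruct Hi as [p Hp].
  destruct (cone_angle_frame k 3 u w i p) as (Hh & _ & _); [fold th; lra|exact Hp|].
  destruct (canon_mid_angle k 3 u w i Hh) as [E1 E2].
  fold m alpha in E1, E2. unfold cone_bound. fold th. rewrite <- E1, <- E2.
  pose proof (cos_half_pos th Hth). pose proof (spread_den_pos th Hth).
  unfold rise, spread. field. split; lra.
Qed.
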